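(* Let $\mathcal{X}\subseteq\mathbb{R}^d$ be compact, $c\ge2$ an integer, and let $\mathcal{S}=\{(\mathbf{x}_i,y_i)\}_{i=1}^n$ be i.i.d. samples from an arbitrary joint distribution $P_{XY}$ on $\mathcal{X}\times\{1,\dots,c\}$. Let $S\colon\mathcal{X}\times\mathcal{X}\to[0,1]$ be symmetric and continuous, and assume that the eigenvalues $\lambda_k$ and orthonormal eigenfunctions $\phi_k$ of the integral operator $(L_Sf)(\mathbf{x})=\int S(\mathbf{x},\mathbf{t})f(\mathbf{t})\,d\mathbf{t}$ satisfy $\sum_{k\ge1}\lambda_k|\phi_k(\mathbf{x})|^2<C$ for all $\mathbf{x}\in\mathcal{X}$ and some constant $C>0$; let $S^{+}(\mathbf{x},\mathbf{t})=\sum_{k:\lambda_k\ge0}\lambda_k\phi_k(\mathbf{x})\phi_k(\mathbf{t})$ and $S^{-}(\mathbf{x},\mathbf{t})=\sum_{k:\lambda_k<0}|\lambda_k|\phi_k(\mathbf{x})\phi_k(\mathbf{t})$ (so that $S=S^+-S^-$). Let $\boldsymbol{\alpha}=(\alpha_1,\dots,\alpha_n)^\top$ with $\boldsymbol{\alpha}\ge0$, $\mathbf{1}^\top\boldsymbol{\alpha}=1$, define $h_S(\mathbf{x},y)=\sum_{i:y_i=y}\alpha_iS(\mathbf{x},\mathbf{x}_i)$ and the classifier $f_S(\mathbf{x})=\arg\max_{y\in\{1,\dots,c\}}h_S(\mathbf{x},y)$. Let $B^+,B^-,R>0$ be constants and suppose $\Omega^{+}(\boldsymbol{\alpha})\le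 (B^{+})^2$, $\Omega^{-}(\boldsymbol{\alpha})\le (B^{-})^2$, $\sup_{\mathbf{x}\in\mathcal{X}}|S^{+}(\mathbf{x},\mathbf{x})|\le R^2$ and $\sup_{\mathbf{x}\in\mathcal{X}}|S^{-}(\mathbf{x},\mathbf{x})|\le R^2$. Let $\gamma>0$ and $\delta\in(0,1)$. Then with probability at least $1-\delta$ over $\mathcal{S}$, $$R(f_S)=\Pr[Y\neq f_S(X)]\le \hat R_n(f_S)+\frac{8R(2c-1)c(B^++B^-)}{\gamma\sqrt n}+\Big(\frac{16c(2c-1)(B^++B^-)R^2}{\gamma}+1\Big)\sqrt{\frac{\log(4/\delta)}{2n}},$$ where $\hat R_n(f_S)=\frac1n\sum_{i=1}^n\Phi\Big(\frac{h_S(\mathbf{x}_i,y_i)-\max_{y'\neq y_i}h_S(\mathbf{x}_i,y')}{\gamma}\Big)$ and $\Phi(x)=\min\{1,\max\{0,1-x\}\}$. Moreover, if $\gamma\ge1$, then $$\hat R_n(f_S)\le 1-\frac{1}{n\gamma}\sum_{i,j=1}^n\frac{\alpha_i+\alpha_j}{2}S(\mathbf{x}_i,\mathbf{x}_j)+\frac{1}{n\gamma}\sum_{1\le i<j\le n}2(\alpha_i+\alpha_j)S(\mathbf{x}_i,\mathbf{x}_j)\mathbb{1}_{y_i\neq y_j}.$$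
   Context: For $y\in\{1,\dots,c\}$, $\boldsymbol{\alpha}^{(y)}\in\mathbb{R}^n$ has entries $\alpha^{(y)}_i=\alpha_i$ if $y_i=y$ and $0$ otherwise. $\mathbf{S}^{+},\mathbf{S}^{-}\in\mathbb{R}^{n\times n}$ are the Gram matrices $[\mathbf{S}^{\pm}]_{ij}=S^{\pm}(\mathbf{x}_i,\mathbf{x}_j)$, and $\Omega^{+}(\boldsymbol{\alpha})=\sum_{y=1}^c{\boldsymbol{\alpha}^{(y)}}^\top\mathbf{S}^{+}\boldsymbol{\alpha}^{(y)}$, $\Omega^{-}(\boldsymbol{\alpha})=\sum_{y=1}^c{\boldsymbol{\alpha}^{(y)}}^\top\mathbf{S}^{-}\boldsymbol{\alpha}^{(y)}$. $\mathbb{1}_E$ is $1$ if $E$ holds and $0$ otherwise. *)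

(* Defs.v *)
From HB Require Import structures.
From mathcomp Require Import all_boot all_order all_algebra.
From mathcomp Require Import all_classical all_reals all_analysis.
Set Implicit Arguments. Unset Strict Implicit. Unset Printing Implicit Defensive.
Import Order.TTheory GRing.Theory Num.Theory.
Import numFieldNormedType.Exports.
Local Open Scope classical_set_scope.
Local Open Scope ring_scope.

Section defs.
Context {R : realType}.

(** Points of R^d are d-tuples of reals (these carry the product = Borel
    sigma-algebra of the library).  Topological notions are transported
    through the canonical bijection with row vectors 'rV[R]_d. *)
Definition vec_of_tuple d (t : d.-tuple R) : 'rV[R]_d := \row_(i < d) tnth t i.
Definition tuple_of_vec d (v : 'rV[R]_d) : d.-tuple R := [tuple v ord0 i | i < d].

Definition compact_tup d (X : set (d.-tuple R)) : Prop :=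
  compact (@vec_of_tuple d @` X).

Definition continuous_on_sq d (X : set (d.-tuple R))
    (S : d.-tuple R -> d.-tuple R -> R) : Prop :=
  {within (@vec_of_tuple d @` X) `*` (@vec_of_tuple d @` X),
    continuous (fun p : 'rV[R]_d * 'rV[R]_d =>
      S (tuple_of_vec p.1) (tuple_of_vec p.2))}.

Definition is_lebesgue_tuple d (mu : {measure set (d.-tuple R) -> \bar R}) : Prop :=
  forall a b : d.-tuple R, (forall i, tnth a i <= tnth b i) ->
    mu [set x | forall i, tnth a i <= tnth x i <= tnth b i] =
    (\prod_(i < d) (tnth b i - tnth a i))%:E.

Definition Splus d (lam : nat -> R) (phi : nat -> d.-tuple R -> R)
    (x t : d.-tuple R) : R :=
  limn (series (fun k => if 0 <= lam k then lam k * phi k x * phi k t else 0)).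
Definition Sminus d (lam : nat -> R) (phi : nat -> d.-tuple R -> R)
    (x t : d.-tuple R) : R :=
  limn (series (fun k => if lam k < 0 then `|lam k| * phi k x * phi k t else 0)).

Definition alpha_lab n (alpha : 'I_n -> R) (ys : 'I_n -> nat) (y : nat)
    (i : 'I_n) : R := if ys i == y then alpha i else 0.

(** Omega_K(alpha) = sum_{y} alpha^(y)^T K alpha^(y), with K the Gram matrix
    of the kernel K on the sample points xs; labels are 0, ..., c-1. *)
Definition Omega d n (c : nat) (K : d.-tuple R -> d.-tuple R -> R)
    (xs : 'I_n -> d.-tuple R) (ys : 'I_n -> nat) (alpha : 'I_n -> R) : R :=
  \sum_(y < c) \sum_(i < n) \sum_(j < n)
     alpha_lab alpha ys y i * K (xs i) (xs j) * alpha_lab alpha ys y j.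

Definition hS d n (S : d.-tuple R -> d.-tuple R -> R)
    (xs : 'I_n -> d.-tuple R) (ys : 'I_n -> nat) (alpha : 'I_n -> R)
    (x : d.-tuple R) (y : nat) : R :=
  \sum_(i < n | ys i == y) alpha i * S x (xs i).

Definition fS d (c : nat) (y0 : 'I_c) (h : d.-tuple R -> nat -> R)
    (x : d.-tuple R) : nat :=
  nat_of_ord ([arg max_(y > y0) h x (nat_of_ord y)])%O.

(** max_{y' < c, y' <> y} g y'  (the initial value is itself an admissible
    label when c >= 2, so this is exactly the maximum) *)
Definition max_other (c : nat) (g : nat -> R) (y : nat) : R :=
  \big[Num.max/g (if y == 0%N then 1%N else 0%N)]_(y' < c | nat_of_ord y' != y) g y'.

Definition ramp (x : R) : R := Num.min 1 (Num.max 0 (1 - x)).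

Definition emp_risk d n (c : nat) (gamma : R) (h : d.-tuple R -> nat -> R)
    (xs : 'I_n -> d.-tuple R) (ys : 'I_n -> nat) : R :=
  n%:R^-1 * \sum_(i < n) ramp ((h (xs i) (ys i) - max_other c (h (xs i)) (ys i)) / gamma).

(** true risk Pr[Y <> f(X)] under P_XY (supported on X x {0..c-1}) *)
Definition risk d (X : set (d.-tuple R))
    (PXY : probability (d.-tuple R * nat)%type R) (f : d.-tuple R -> nat) : \bar R :=
  PXY [set z | X z.1 /\ z.2 != f z.1].

Definition iid_sample (dO : measure_display) (Om : measurableType dO)
    (P : probability Om R) (dT : measure_display) (T : measurableType dT)
    n (Z : 'I_n -> Om -> T) (PZ : probability T R) : Prop :=
  (forall i, measurable_fun [set: Om] (Z i)) /\
  forall A : 'I_n -> set T, (forall i, measurable (A i)) ->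
    P (\bigcap_(i in [set: 'I_n]) (Z i @^-1` A i)) = (\prod_(i < n) PZ (A i))%E.

End defs.

(* Main.v *)
(** The class of all scores compatible with the constraints on Omega is the ball of
    radius Bp + Bm in a weighted l2-space whose feature maps are sqrt |lam_k| phi_k;
    the signs of the eigenvalues are absorbed in the weights. Finitely supported
    rational weights are dense in it, so it is enough to bound the maximum F of the
    deviations (true minus empirical margin loss) over a finite subclass, uniformly in
    the subclass. McDiarmid's inequality concentrates F around its mean. The mean is
    bounded by replacing the sample points one at a time by a random sign: a ghost copy
    symmetrizes the summand, the Lipschitz bound of the margin loss contracts it to a
    linear functional of the weights, and a quadratic potential absorbs the result. *)

Require Import Defs.
From HB Require Import structures.
From mathcomp Require Import all_boot all_order all_algebra.
From mathcomp Require Import all_classical all_reals all_analysis.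
From mathcomp Require Import measurable_realfun ring lra.
Import Order.TTheory GRing.Theory Num.Theory.
Import numFieldNormedType.Exports.
Local Open Scope classical_set_scope.
Local Open Scope ring_scope.
Set Implicit Arguments. Unset Strict Implicit. Unset Printing Implicit Defensive.

(** * Independent samples *)

(** The coefficients alpha may depend on the sample, so their scores are placed in a class that does
    not. Up to the sign of [lam k], label y has as its k-th weight the alpha^(y)-combination of the
    k-th features of the sample points. Summed over labels, the squared norm of these weights is
    Omega^+ + Omega^-, hence at most Bp^2 + Bm^2 <= (Bp + Bm)^2: the ball is known before the sample
    is drawn, and one exceptional event serves every alpha. Over a finite subclass the maxima are
    measurable and attained; symmetrization compares two maximizers. None of the bounds sees the
    size of the subclass, so they pass to the countable class by continuity from below. The actual
    score need not belong to that class: it is a pointwise limit on X of class members, and the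
    bound reaches it by dominated convergence. The margin loss sees c scores at once. Sharing the
    maxima evenly among the labels reduces it to one linear functional at a time, at the price of a
    factor c. The random sign is never a random variable, only the half-sum of two maxima. *)

Section bounded_expectation.
Context {dW : measure_display} {W : measurableType dW} {R : realType}.
Implicit Types (P : probability W R) (f g : W -> R).

(** Such functions are integrable for every probability and stable under all operations used below,
    so one predicate discharges every integrability condition. *)
Definition bounded_mfun f :=
  measurable_fun [set: W] f /\ exists M, forall x, `|f x| <= M.

Lemma bounded_mfun_integrable P f :
  bounded_mfun f -> P.-integrable [set: W] (EFin \o f).
Proof.
case=> mf [M fM]; apply: measurable_bounded_integrable => //.
  by rewrite -ge0_fin_numE// fin_num_measure.
exists M; split; first exact: num_real.
by move=> y My x _; apply: le_trans (fM x) (ltW My).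
Qed.

Lemma bounded_mfun_cst (r : R) : bounded_mfun (fun=> r).
Proof. by split; [exact: measurable_cst|exists `|r|]. Qed.

Lemma bounded_mfunD f g :
  bounded_mfun f -> bounded_mfun g -> bounded_mfun (fun x => f x + g x).
Proof.
move=> [mf [M fM]] [mg [N gN]]; split; first exact: measurable_funD.
by exists (M + N) => x; apply: le_trans (ler_normD _ _) (lerD (fM x) (gN x)).
Qed.

Lemma bounded_mfunM f g :
  bounded_mfun f -> bounded_mfun g -> bounded_mfun (fun x => f x * g x).
Proof.
move=> [mf [M fM]] [mg [N gN]]; split; first exact: measurable_funM.
by exists (M * N) => x; rewrite normrM ler_pM.
Qed.

Lemma bounded_mfunN f : bounded_mfun f -> bounded_mfun (fun x => - f x).
Proof.
move=> [mf [M fM]]; split; first exact: measurableT_comp.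
by exists M => x; rewrite normrN.
Qed.

Lemma bounded_mfunB f g :
  bounded_mfun f -> bounded_mfun g -> bounded_mfun (fun x => f x - g x).
Proof. by move=> bf bg; apply: bounded_mfunD bf (bounded_mfunN bg). Qed.

Lemma bounded_mfun_expR f :
  bounded_mfun f -> bounded_mfun (fun x => expR (f x)).
Proof.
move=> [mf [M fM]]; split; first exact: measurableT_comp.
exists (expR M) => x; rewrite ger0_norm ?expR_ge0// ler_expR.
exact: le_trans (ler_norm _) (fM x).
Qed.

Lemma bounded_mfun_sum (I : Type) (r : seq I) (F : I -> W -> R) :
  (forall i, bounded_mfun (F i)) -> bounded_mfun (fun x => \sum_(i <- r) F i x).
Proof.
move=> bF; elim: r => [|i r ih].
  rewrite (_ : (fun _ => _) = fun=> 0); first exact: bounded_mfun_cst.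
  by apply/funext => x; rewrite big_nil.
rewrite (_ : (fun _ => _) = fun x => F i x + \sum_(j <- r) F j x).
  exact: bounded_mfunD.
by apply/funext => x; rewrite big_cons.
Qed.

Lemma bounded_mfun_max f g :
  bounded_mfun f -> bounded_mfun g -> bounded_mfun (fun x => Num.max (f x) (g x)).
Proof.
move=> [mf [M fM]] [mg [N gN]]; split; first exact: measurable_maxr.
exists (Num.max M N) => x; case: (leP (f x) (g x)) => _;
  by rewrite le_max ?fM ?gN ?orbT.
Qed.

Lemma bounded_mfun_bigmax (I : Type) (r : seq I) f (F : I -> W -> R) :
  bounded_mfun f -> (forall i, bounded_mfun (F i)) ->
  bounded_mfun (fun x => \big[Num.max/f x]_(i <- r) F i x).
Proof.
move=> bf bF; elim: r => [|i r ih].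
  by under eq_fun do rewrite big_nil.
under eq_fun do rewrite big_cons.
exact: bounded_mfun_max.
Qed.

Lemma Rintegral_prob_cst P (r : R) : \int[P]_x r = r.
Proof. by rewrite Rintegral_cst// (congr1 fine (probability_setT P)) mulr1. Qed.

Lemma le_Rintegral_bounded P f g : bounded_mfun f -> bounded_mfun g ->
  (forall x, f x <= g x) -> \int[P]_x f x <= \int[P]_x g x.
Proof. by move=> bf bg fg; apply: le_Rintegral => //; exact: bounded_mfun_integrable. Qed.

Lemma Rintegral_bounded_le P f (r : R) : bounded_mfun f ->
  (forall x, f x <= r) -> \int[P]_x f x <= r.
Proof.
move=> bf fr; rewrite -[leRHS](Rintegral_prob_cst P).
by apply: le_Rintegral_bounded => //; exact: bounded_mfun_cst.
Qed.

Lemma Rintegral_bounded_ge P f (r : R) : bounded_mfun f ->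
  (forall x, r <= f x) -> r <= \int[P]_x f x.
Proof.
move=> bf fr; rewrite -[leLHS](Rintegral_prob_cst P).
by apply: le_Rintegral_bounded => //; exact: bounded_mfun_cst.
Qed.

Lemma RintegralD_bounded P f g : bounded_mfun f -> bounded_mfun g ->
  \int[P]_x (f x + g x) = \int[P]_x f x + \int[P]_x g x.
Proof. by move=> bf bg; apply: RintegralD => //; exact: bounded_mfun_integrable. Qed.

Lemma RintegralB_bounded P f g : bounded_mfun f -> bounded_mfun g ->
  \int[P]_x (f x - g x) = \int[P]_x f x - \int[P]_x g x.
Proof. by move=> bf bg; apply: RintegralB => //; exact: bounded_mfun_integrable. Qed.

Lemma RintegralZl_bounded P (r : R) f : bounded_mfun f ->
  \int[P]_x (r * f x) = r * \int[P]_x f x.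
Proof. by move=> bf; apply: RintegralZl => //; exact: bounded_mfun_integrable. Qed.

Lemma Rintegral_sum_bounded P (I : Type) (r : seq I) (F : I -> W -> R) :
  (forall i, bounded_mfun (F i)) ->
  \int[P]_x (\sum_(i <- r) F i x) = \sum_(i <- r) \int[P]_x F i x.
Proof.
move=> bF; elim: r => [|i r ih].
  rewrite big_nil -[RHS](Rintegral_prob_cst P).
  by apply: eq_Rintegral => x _; rewrite big_nil.
rewrite big_cons -ih -RintegralD_bounded//; last exact: bounded_mfun_sum.
by apply: eq_Rintegral => x _; rewrite big_cons.
Qed.

Lemma bounded_RintegralEFin P f : bounded_mfun f ->
  (\int[P]_x f x)%:E = (\int[P]_x (f x)%:E)%E.
Proof.
move=> bf; rewrite /Rintegral fineK//; apply: integrable_fin_num => //.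
exact: bounded_mfun_integrable.
Qed.

Lemma normr_Rintegral_bounded P f (M : R) : bounded_mfun f ->
  (forall x, `|f x| <= M) -> `|\int[P]_x f x| <= M.
Proof.
move=> bf fM; rewrite ler_norml Rintegral_bounded_le ?andbT//.
  by apply: Rintegral_bounded_ge => // x; have := fM x; rewrite ler_norml => /andP[].
by move=> x; exact: le_trans (ler_norm _) (fM x).
Qed.

End bounded_expectation.

Lemma bounded_mfun_comp {dV dW : measure_display} {V : measurableType dV}
    {W : measurableType dW} {R : realType} (f : W -> R) (g : V -> W) :
  bounded_mfun f -> measurable_fun [set: V] g -> bounded_mfun (f \o g).
Proof.
by move=> [mf [M fM]] mg; split; [exact: measurableT_comp|exists M => x; exact: fM].
Qed.

Section bounded_fubini.
Context {dV dW : measure_display} {V : measurableType dV}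
  {W : measurableType dW} {R : realType}.
Variables (P : probability V R) (Q : probability W R).
Implicit Types f : V * W -> R.

Lemma bounded_mfun_pair1 f x : bounded_mfun f -> bounded_mfun (fun y => f (x, y)).
Proof. by move=> bf; apply: (bounded_mfun_comp bf); exact: pair1_measurable. Qed.

Lemma bounded_mfun_pair2 f y : bounded_mfun f -> bounded_mfun (fun x => f (x, y)).
Proof. by move=> bf; apply: (bounded_mfun_comp bf); exact: pair2_measurable. Qed.

Lemma bounded_mfun_Rintegral2 f :
  bounded_mfun f -> bounded_mfun (fun x => \int[Q]_y f (x, y)).
Proof.
move=> bf; split.
  apply/measurable_EFinP.
  have := measurable_fubini_F (bounded_mfun_integrable (P \x Q)%E bf).
  congr measurable_fun; apply/funext => x; rewrite /= bounded_RintegralEFin//.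
  exact: bounded_mfun_pair1.
have [_ [M fM]] := bf; exists M => x.
by apply: normr_Rintegral_bounded => //; exact: bounded_mfun_pair1.
Qed.

Lemma bounded_mfun_Rintegral1 f :
  bounded_mfun f -> bounded_mfun (fun y => \int[P]_x f (x, y)).
Proof.
move=> bf; split.
  apply/measurable_EFinP.
  have := measurable_fubini_G (bounded_mfun_integrable (P \x Q)%E bf).
  congr measurable_fun; apply/funext => y; rewrite /= bounded_RintegralEFin//.
  exact: bounded_mfun_pair2.
have [_ [M fM]] := bf; exists M => y.
by apply: normr_Rintegral_bounded => //; exact: bounded_mfun_pair2.
Qed.

Lemma Rintegral_prod12 f : bounded_mfun f ->
  \int[(P \x Q)%E]_z f z = \int[P]_x \int[Q]_y f (x, y).
Proof.
move=> bf; apply: EFin_inj; rewrite (bounded_RintegralEFin (P \x Q)%E bf).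
rewrite bounded_RintegralEFin; last exact: bounded_mfun_Rintegral2.
rewrite -(integral12_prod_meas1 (bounded_mfun_integrable (P \x Q)%E bf)).
apply: eq_integral => x _; rewrite bounded_RintegralEFin//.
exact: bounded_mfun_pair1.
Qed.

Lemma Rintegral_prod21 f : bounded_mfun f ->
  \int[(P \x Q)%E]_z f z = \int[Q]_y \int[P]_x f (x, y).
Proof.
move=> bf; apply: EFin_inj; rewrite (bounded_RintegralEFin (P \x Q)%E bf).
rewrite bounded_RintegralEFin; last exact: bounded_mfun_Rintegral1.
rewrite -(integral21_prod_meas1 (bounded_mfun_integrable (P \x Q)%E bf)).
apply: eq_integral => x _; rewrite bounded_RintegralEFin//.
exact: bounded_mfun_pair2.
Qed.

End bounded_fubini.

(** * The iterated product law of n independent draws *)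

Section iid_measure.
Context {dT : measure_display} {T : measurableType dT} {R : realType}.

Definition tcons n (p : T * n.-tuple T) : n.+1.-tuple T :=
  [the n.+1.-tuple T of p.1 :: p.2].

Lemma measurable_tcons n : measurable_fun [set: T * n.-tuple T] (@tcons n).
Proof. exact: measurable_cons. Qed.

HB.instance Definition _ n := isMeasurableFun.Build _ _ _ _ (@tcons n) (@measurable_tcons n).

Variable mu : probability T R.

(** Built by adjoining one point in front, so that integrals over a sample can be peeled one point
    at a time; McDiarmid's inequality and the symmetrization both run along this recursion. *)
Fixpoint iid n : probability (n.-tuple T) R :=
  match n with
  | 0 => dirac ([tuple] : 0.-tuple T)
  | n'.+1 => distribution (mu \x iid n')%E (@tcons n')
  end.

Lemma Rintegral_iid0 (f : 0.-tuple T -> R) : bounded_mfun f ->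
  \int[iid 0]_t f t = f [tuple].
Proof.
move=> bf; rewrite -[RHS](Rintegral_prob_cst (iid 0)).
by apply: eq_Rintegral => t _; rewrite (tuple0 t).
Qed.

Lemma Rintegral_iidS n (f : n.+1.-tuple T -> R) : bounded_mfun f ->
  \int[iid n.+1]_t f t = \int[(mu \x iid n)%E]_p f (tcons p).
Proof.
move=> bf; rewrite /Rintegral; congr fine.
rewrite /= /distribution integral_pushforward//.
- by apply/measurable_EFinP; case: bf.
- rewrite preimage_setT; apply: bounded_mfun_integrable.
  by apply: bounded_mfun_comp.
Qed.

Lemma probability_Rintegral_indic {dW : measure_display} {W : measurableType dW}
  (P : probability W R) (A : set W) : measurable A -> P A = (\int[P]_x \1_A x)%:E.
Proof.
move=> mA; rewrite bounded_RintegralEFin.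
  by rewrite integral_indic// setIT.
split; first exact: measurable_indic.
by exists 1 => x; rewrite ger0_norm// indicE; case: (_ \in _).
Qed.

End iid_measure.

Lemma tnth_tcons0 {dT : measure_display} {T : measurableType dT} n
  (p : T * n.-tuple T) : tnth (tcons p) ord0 = p.1.
Proof. by []. Qed.

Lemma tnth_tconsS {dT : measure_display} {T : measurableType dT} n
  (p : T * n.-tuple T) i : tnth (tcons p) (lift ord0 i) = tnth p.2 i.
Proof. by rewrite /tcons tnthS. Qed.

Section iid_law.
Context {dT : measure_display} {T : measurableType dT} {R : realType}.
Implicit Type mu : probability T R.

Definition tuple_rect n (A : 'I_n -> set T) : set (n.-tuple T) :=
  \bigcap_(i in [set: 'I_n]) (@tnth n T ^~ i @^-1` A i).

Lemma measurable_tuple_rect n (A : 'I_n -> set T) :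
  (forall i, measurable (A i)) -> measurable (tuple_rect A).
Proof.
move=> mA; apply: fin_bigcap_measurable => // i _.
by rewrite -[X in measurable X]setTI; exact: measurable_tnth.
Qed.

(** A generating cylinder constrains one coordinate and is the rectangle whose other sides are the
    whole space. Rectangles are stable under intersection, as uniqueness of measures asks of a
    generator. *)
Lemma measurable_tuple_rectE n :
  @measurable _ (n.-tuple T) =
  <<s [set B | exists2 A : 'I_n -> set T, (forall i, measurable (A i)) &
                 B = tuple_rect A] >>.
Proof.
apply/seteqP; split; last first.
  apply: smallest_sub; first exact: sigma_algebra_measurable.
  by move=> _ [A mA ->]; exact: measurable_tuple_rect.
apply: smallest_sub; first exact: smallest_sigma_algebra.
rewrite -bigcup_seq => B [i _ [C mC <-]].
apply: sub_sigma_algebra; exists (fun j => if j == i then C else setT).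
  by move=> j; case: ifP.
rewrite setTI; apply/seteqP; split=> t /=.
  by move=> Ct j _ /=; case: eqP => // ->.
by move=> /(_ i Logic.I); rewrite /= eqxx.
Qed.

Lemma iid_rect mu n (A : 'I_n -> set T) : (forall i, measurable (A i)) ->
  iid mu n (tuple_rect A) = (\prod_(i < n) mu (A i))%E.
Proof.
elim: n A => [|n ih] A mA.
  rewrite big_ord0 (_ : tuple_rect A = setT) ?probability_setT//.
  by apply/seteqP; split=> // t _ [].
rewrite big_ord_recl -ih// -product_measure1E//; last exact: measurable_tuple_rect.
rewrite /= /distribution /pushforward; congr product_measure1; apply/seteqP; split => -[x t] /=.
  move=> Axt; split; first exact: (Axt ord0).
  by move=> i _ /=; have := Axt (lift ord0 i) Logic.I; rewrite /= tnth_tconsS.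
move=> [Ax At] i _ /=; case: (unliftP ord0 i) => [j ->|-> //].
by rewrite tnth_tconsS; exact: At.
Qed.

(** The joint law of the sample and [iid mu n] agree on rectangles, hence on all measurable sets;
    estimates proved on the tuple space thus transfer to [Om]. *)
Lemma iid_sample_law {dO : measure_display} {Om : measurableType dO}
    (P : probability Om R) mu n (Z : 'I_n -> Om -> T) (B : set (n.-tuple T)) :
  iid_sample P Z mu -> measurable B ->
  P ((fun w => [tuple Z i w | i < n]) @^-1` B) = iid mu n B.
Proof.
move=> [mZ indZ] mB.
have mZt : measurable_fun [set: Om] (fun w => [tuple Z i w | i < n]).
  apply/measurable_fun_tnthP => i.
  by rewrite (_ : _ \o _ = Z i)//; apply/funext => w /=; rewrite tnth_mktuple.
pose Zt : {mfun Om >-> n.-tuple T} := mfun_Sub (mem_set mZt).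
pose G := [set B | exists2 A : 'I_n -> set T, (forall i, measurable (A i)) &
                 B = tuple_rect A].
have GT : G setT by exists (fun=> setT) => //; apply/seteqP; split.
suff : distribution P Zt B = iid mu n B by [].
apply: (measure_unique G (fun=> setT)) => //.
- exact: measurable_tuple_rectE.
- move=> _ _ [A mA ->] [C mC ->]; exists (fun i => A i `&` C i).
    by move=> i; exact: measurableI.
  by rewrite /tuple_rect -bigcapI; apply: eq_bigcapr.
- by rewrite bigcup_const//; exists 0%N.
- move=> _ [A mA ->]; apply: etrans (esym (iid_rect mu mA)); rewrite -indZ//.
  rewrite /distribution /pushforward/=; congr (P _).
  by apply/seteqP; split => w /= H i _; move: (H i Logic.I) => /=; rewrite tnth_mktuple.
- move=> _; rewrite -ge0_fin_numE//; exact: (fin_num_measure (distribution P Zt)).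
Qed.

End iid_law.

(** * Hoeffding's lemma and McDiarmid's inequality *)

Section hoeffding_scalar.
Context {R : realType}.

Lemma ge0_derive_le0 (f df : R -> R) (t : R) : 0 <= t ->
  (forall x : R, is_derive x 1 f (df x)) -> (forall x, 0 <= x -> 0 <= df x) ->
  f 0 <= f t.
Proof.
move=> t0 fdf df0.
have cf : {within `[0, t], continuous f}.
  by apply: derivable_within_continuous => x _; case: (fdf x).
have [c /itvP c0t ft] := MVT_segment t0 (fun x _ => fdf x) cf.
by rewrite -subr_ge0 ft mulr_ge0// ?subr_ge0// df0// c0t.
Qed.

(* The logarithm of the moment generating function of a Bernoulli variable has
   second derivative r (1 - r) <= 1/4, where r is the tilted success probability. *)
Lemma bernoulli_mgf_le (p t : R) : 0 <= p <= 1 -> 0 <= t ->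
  (1 - p) * expR (- (t * p)) + p * expR (t * (1 - p)) <= expR (t ^+ 2 / 8).
Proof.
move=> /andP[p0 p1] t0.
pose q x : R := 1 - p + p * expR x.
have q0 x : 0 < q x.
  rewrite /q; have := expR_gt0 x; move: p0; rewrite le_eqVlt => /predU1P[<-|p0] ex0.
    by rewrite subr0 mul0r addr0.
  by apply: ltr_wpDl; [rewrite subr_ge0|exact: mulr_gt0].
(* The tilted probability p e^x / q(x), written as one exponential: the chain rule then gives r' = r
   (1 - r) without a quotient. *)
pose r x : R := p * expR (x - ln (q x)).
have rE x : r x = p * expR x / q x by rewrite /r expRB lnK ?posrE// mulrA.
have dq (x : R) : is_derive x 1 q (p * expR x).
  rewrite /q; apply: is_derive_eq.
  by rewrite /GRing.scale/= ?scaler0; ring.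
have dlnq (x : R) : is_derive x 1 (fun y => ln (q y)) (r x).
  have := @is_derive1_comp R (@ln R) q x _ _ (is_derive1_ln (q0 x)) (dq x).
  by rewrite (_ : _^-1 * _ = r x)// rE mulrC.
have dr (x : R) : is_derive x 1 r (r x * (1 - r x)).
  have dxl : is_derive x 1 (fun y => y - ln (q y)) (1 - r x).
    exact: is_deriveB.
  have de := @is_derive1_comp R (@expR R) (fun y => y - ln (q y)) x _ _
    (is_derive_expR _) dxl.
  have := is_deriveZ p de.
  rewrite (_ : p *: _ = r x * (1 - r x)) /GRing.scale/=; last by rewrite /r mulrA.
  exact.
pose g x : R := 4^-1 * x + p - r x.
have dg (x : R) : is_derive x 1 g (4^-1 - r x * (1 - r x)).
  apply: is_derive_eq; rewrite /GRing.scale/=; ring.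
have g0 x : 0 <= x -> 0 <= g x.
  move=> x0; have <- : g 0 = 0.
    by rewrite /g mulr0 add0r rE /q expR0 mulr1 subrK divr1 subrr.
  apply: ge0_derive_le0 dg _ => // y _.
  have -> : 4^-1 - r y * (1 - r y) = (r y - 2^-1) ^+ 2 by field.
  exact: sqr_ge0.
(* [f] has derivative [g], and [g] has derivative (r - 1/2)^2; both vanish at 0, so two integrations
   give [0 <= f t]. *)
pose f x : R := 8^-1 * (x * x) + p * x - ln (q x).
have df (x : R) : is_derive x 1 f (g x).
  apply: is_derive_eq; rewrite /GRing.scale/= /g. lra.
have := ge0_derive_le0 t0 df g0.
rewrite {1}/f !mulr0 addr0 /q expR0 mulr1 subrK ln1 subrr => ft0.
have -> : (1 - p) * expR (- (t * p)) + p * expR (t * (1 - p)) =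
   expR (ln (q t) - p * t).
  rewrite expRD lnK ?posrE// mulrBr mulr1 expRD (mulrC t) /q; ring.
rewrite ler_expR; rewrite -subr_ge0; apply: le_trans ft0 _.
by rewrite /f; lra.
Qed.

End hoeffding_scalar.

Section mcdiarmid.
Context {R : realType}.

(** With a the infimum of the centred function, its values lie in [a, a + 1], and convexity puts exp
    below its chord there. Since the mean is 0, the chord integrates to the moment generating
    function of a centred Bernoulli variable of success probability -a. *)
Lemma hoeffding_mgf {dW : measure_display} {W : measurableType dW}
    (P : probability W R) (f : W -> R) (s : R) :
  bounded_mfun f -> (forall x y, f x - f y <= 1) -> 0 <= s ->
  \int[P]_x expR (s * (f x - \int[P]_y f y)) <= expR (s ^+ 2 / 8).
Proof.
move=> bf f1 s0; set m := \int[P]_y f y.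
pose g x := f x - m.
have bg : bounded_mfun g by apply: bounded_mfunB => //; exact: bounded_mfun_cst.
have [x0 _] : exists x : W, True.
  apply: contrapT => nW; have := probability_setT P.
  rewrite (_ : setT = set0); first by rewrite measure0 => /eqP; rewrite eqe eq_sym oner_eq0.
  by apply/seteqP; split=> // x _; apply: nW; exists x.
have g_int : \int[P]_x g x = 0.
  by rewrite RintegralB_bounded// ?Rintegral_prob_cst ?subrr//; exact: bounded_mfun_cst.
have hinf : has_inf (range g).
  split; first by exists (g x0), x0.
  by exists (g x0 - 1) => _ [x _ <-]; rewrite /g; have := f1 x0 x; lra.
pose a := inf (range g).
have ag x : a <= g x by apply: ge_inf; [exact: hinf.2|exists x].
have ga x : g x <= a + 1.
  rewrite -lerBlDr; apply: lb_le_inf; first by exists (g x0), x0.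
  by move=> _ [y _ <-]; rewrite /g; have := f1 x y; lra.
have a0 : a <= 0 by rewrite -g_int; exact: Rintegral_bounded_ge.
have a1 : 0 <= a + 1 by rewrite -g_int; exact: Rintegral_bounded_le.
have key x : expR (s * g x) <=
    (1 - - a) * expR (- (s * - a)) + (- a) * expR (s * (1 - - a)) +
    (expR (s * (1 - - a)) - expR (- (s * - a))) * g x.
  (* the graph of exp lies above its tangent at [s * g x] *)
  have e1 := expR_ge1Dx (s * (a - g x)).
  have e2 := expR_ge1Dx (s * (a + 1 - g x)).
  have E0 := expR_gt0 (s * g x).
  have -> : expR (- (s * - a)) = expR (s * g x) * expR (s * (a - g x)).
    by rewrite -expRD; congr expR; ring.
  have -> : expR (s * (1 - - a)) = expR (s * g x) * expR (s * (a + 1 - g x)).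
    by rewrite -expRD; congr expR; ring.
  have h1 : (1 + s * (a - g x)) * (a + 1 - g x) <=
    expR (s * (a - g x)) * (a + 1 - g x).
    by rewrite ler_wpM2r// subr_ge0.
  have h2 : (1 + s * (a + 1 - g x)) * (g x - a) <=
    expR (s * (a + 1 - g x)) * (g x - a).
    by rewrite ler_wpM2r// subr_ge0.
  have -> : forall E e e' y : R, (1 - - a) * (E * e) + - a * (E * e') + (E * e' - E * e) * y =
    E * (e * (a + 1 - y) + e' * (y - a)) by move=> *; ring.
  (* The chord weights [a + 1 - g x] and [g x - a] sum to 1, and the terms carrying s in the two
     tangent bounds cancel. *)
  rewrite -[leLHS]mulr1 ler_pM2l//; apply: le_trans (lerD h1 h2).
  rewrite le_eqVlt; apply/predU1P; left; ring.
have bk : bounded_mfun (fun x => expR (s * g x)).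
  apply: bounded_mfun_expR; apply: bounded_mfunM => //; exact: bounded_mfun_cst.
apply: le_trans (le_Rintegral_bounded P bk _ key) _.
  apply: bounded_mfunD; first exact: bounded_mfun_cst.
  by apply: bounded_mfunM => //; exact: bounded_mfun_cst.
rewrite RintegralD_bounded ?Rintegral_prob_cst; [|exact: bounded_mfun_cst|].
  rewrite RintegralZl_bounded// g_int mulr0 addr0.
  by apply: bernoulli_mgf_le => //; rewrite oppr_ge0 a0/=; lra.
by apply: bounded_mfunM => //; exact: bounded_mfun_cst.
Qed.

Context {dT : measure_display} {T : measurableType dT}.
Variable mu : probability T R.

(** The constant 1 fits unnormalized sums of losses in [0, 1]. The inequality is in effect
    two-sided, as [t] and [t'] may be exchanged. *)
Definition unit_differences n (f : n.-tuple T -> R) :=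
  forall (i : 'I_n) (t t' : n.-tuple T),
    (forall j, j != i -> tnth t j = tnth t' j) -> f t - f t' <= 1.

(** Averaging out the first point leaves a function [f1] of the tail that still has unit
    differences. For a fixed tail, Hoeffding's lemma in the first point costs one factor exp (s^2 /
    8). *)
Lemma mcdiarmid_mgf n (f : n.-tuple T -> R) (s : R) :
  bounded_mfun f -> unit_differences f -> 0 <= s ->
  \int[iid mu n]_t expR (s * (f t - \int[iid mu n]_t f t)) <=
    expR (n%:R * (s ^+ 2 / 8)).
Proof.
move=> + + s0; elim: n f => [|n ih] f bf df.
  rewrite mul0r expR0 Rintegral_iid0; first by rewrite Rintegral_iid0// subrr mulr0 expR0.
  apply: bounded_mfun_expR; apply: bounded_mfunM; first exact: bounded_mfun_cst.
  by apply: bounded_mfunB => //; exact: bounded_mfun_cst.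
have bft : bounded_mfun (f \o @tcons _ T n) by exact: bounded_mfun_comp.
pose f1 t := \int[mu]_z f (tcons (z, t)).
have bf1 : bounded_mfun f1 by exact: (bounded_mfun_Rintegral1 mu (iid mu n) bft).
have bz t : bounded_mfun (fun z => f (tcons (z, t))) by exact: (bounded_mfun_pair2 t bft).
have df1 : unit_differences f1.
  move=> i t t' tt'; rewrite -RintegralB_bounded//.
  apply: Rintegral_bounded_le; first exact: bounded_mfunB.
  move=> z; apply: (df (lift ord0 i)) => j.
  case: (unliftP ord0 j) => [k ->|->]; last by rewrite !tnth_tcons0.
  by rewrite (inj_eq (@lift_inj _ ord0)) !tnth_tconsS; exact: tt'.
have Ef : \int[iid mu n.+1]_t f t = \int[iid mu n]_t f1 t.
  by rewrite Rintegral_iidS// (Rintegral_prod21 _ _ bft).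
have bexp k (h : k.-tuple T -> R) m :
    bounded_mfun h -> bounded_mfun (fun t => expR (s * (h t - m))).
  move=> bh; apply: bounded_mfun_expR; apply: bounded_mfunM; first exact: bounded_mfun_cst.
  by apply: bounded_mfunB => //; exact: bounded_mfun_cst.
rewrite Ef; set m := \int[iid mu n]_t f1 t.
rewrite Rintegral_iidS; last exact: bexp.
have bft' : bounded_mfun (fun p => expR (s * (f (tcons p) - m))).
  exact: (bounded_mfun_comp (bexp _ _ m bf)).
rewrite (Rintegral_prod21 _ _ bft').
rewrite -natr1 mulrDl mul1r expRD mulrC.
apply: le_trans (ler_wpM2l (expR_ge0 _) (ih f1 bf1 df1)).
rewrite -RintegralZl_bounded; last exact: bexp.
apply: le_Rintegral_bounded.
- exact: (bounded_mfun_Rintegral1 mu (iid mu n) bft').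
- by apply: bounded_mfunM; [exact: bounded_mfun_cst|exact: bexp].
move=> t.
rewrite (_ : \int[mu]_x _ = expR (s * (f1 t - m)) *
    \int[mu]_z expR (s * (f (tcons (z, t)) - f1 t))).
  rewrite mulrC ler_wpM2r ?expR_ge0//; apply: hoeffding_mgf => // z z'.
  apply: (df ord0) => j; case: (unliftP ord0 j) => [k ->|->]; last by rewrite eqxx.
  by rewrite !tnth_tconsS.
rewrite -RintegralZl_bounded; first by apply: eq_Rintegral => z _; rewrite -expRD; congr expR; ring.
apply: bounded_mfun_expR; apply: bounded_mfunM; first exact: bounded_mfun_cst.
by apply: bounded_mfunB => //; exact: bounded_mfun_cst.
Qed.

Lemma mcdiarmid n (f : n.-tuple T -> R) (u : R) : (0 < n)%N ->
  bounded_mfun f -> unit_differences f -> 0 <= u ->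
  (iid mu n [set t | (\int[iid mu n]_t f t + u <= f t)%R] <=
     (expR (- (2 * u ^+ 2 / n%:R)))%:E)%E.
Proof.
move=> n0 bf df u0; set m := \int[iid mu n]_t f t; set A := [set t | _].
have nR : 0 < n%:R :> R by rewrite ltr0n.
have mA : measurable A.
  rewrite (_ : A = f @^-1` `[m + u, +oo[); first by rewrite -[X in measurable X]setTI; exact: bf.1.
  by apply/seteqP; split => t /=; rewrite in_itv/= andbT.
rewrite probability_Rintegral_indic// lee_fin.
(* The minimizer of n s^2 / 8 - s u in the Chernoff bound. *)
pose s := 4 * u / n%:R.
have s0 : 0 <= s by rewrite /s divr_ge0// ?mulr_ge0// ltW.
have bE : bounded_mfun (fun t => expR (s * (f t - m))).
  apply: bounded_mfun_expR; apply: bounded_mfunM; first exact: bounded_mfun_cst.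
  by apply: bounded_mfunB => //; exact: bounded_mfun_cst.
have le1 : \int[iid mu n]_t \1_A t <=
    \int[iid mu n]_t (expR (- (s * u)) * expR (s * (f t - m))).
  apply: le_Rintegral_bounded.
  - split; first exact: measurable_indic.
    by exists 1 => x; rewrite ger0_norm// indicE; case: (_ \in _).
  - by apply: bounded_mfunM => //; exact: bounded_mfun_cst.
  move=> t; rewrite indicE; have [|_] := boolP (t \in A); last by rewrite mulr_ge0// expR_ge0.
  rewrite inE /A/= => mut; rewrite -expRD -[leLHS]expR0 ler_expR -mulrN -mulrDr mulr_ge0//; lra.
apply: le_trans le1 _; rewrite RintegralZl_bounded//.
apply: le_trans (ler_wpM2l (expR_ge0 _) (mcdiarmid_mgf bf df s0)) _.
rewrite -expRD ler_expR /s; rewrite le_eqVlt; apply/predU1P; left; field.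
by rewrite gt_eqF.
Qed.

End mcdiarmid.

(** * Uniform deviation over a finite linear class *)

Section finite_maximum.
Context {R : realType} (m : nat).
Implicit Types F G : 'I_m.+1 -> R.

Definition fmax F : R := \big[Num.max/F ord0]_j F j.

Lemma fmax_ge F j : F j <= fmax F.
Proof. exact: le_bigmax. Qed.

Lemma fmax_le F (b : R) : (forall j, F j <= b) -> fmax F <= b.
Proof. by move=> Fb; apply: bigmax_le. Qed.

Lemma fmax_attained F : exists j, fmax F = F j.
Proof.
rewrite /fmax; elim/big_ind : _ => [|x y [i ->] [j ->]|j _]; first by exists ord0.
- by case: (leP (F i) (F j)) => _; [exists j|exists i].
- by exists j.
Qed.

Lemma bounded_mfun_fmax {dW : measure_display} {W : measurableType dW}
    (F : 'I_m.+1 -> W -> R) :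
  (forall j, bounded_mfun (F j)) -> bounded_mfun (fun x => fmax (F ^~ x)).
Proof. by move=> bF; exact: bounded_mfun_bigmax. Qed.

End finite_maximum.

Section symmetrization.
Context {R : realType} {dT : measure_display} {T : measurableType dT}.
Variables (mu : probability T R) (m c : nat) (c_gt0 : (0 < c)%N).
Variables (l : 'I_m.+1 -> T -> R) (h : 'I_m.+1 -> T -> 'I_c -> R) (L : R).
Hypotheses (bl : forall j, bounded_mfun (l j))
  (bh : forall j y, bounded_mfun (fun z => h j z y))
  (lip : forall z j k, l j z - l k z <= L * \sum_y `|h j z y - h k z y|).

(** Twice the expectation, over a uniform random sign, of the maximum of [A j] plus the signed y-th
    score. *)
Definition signed_max (A : 'I_m.+1 -> R) (y : 'I_c) (z : T) : R :=
  fmax (fun j => A j + 2 * c%:R * L * h j z y) +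
  fmax (fun j => A j - 2 * c%:R * L * h j z y).

Lemma bounded_mfun_signed_max A y : bounded_mfun (signed_max A y).
Proof.
apply: bounded_mfunD; apply: bounded_mfun_fmax => j.
- apply: bounded_mfunD; first exact: bounded_mfun_cst.
  by apply: bounded_mfunM => //; exact: bounded_mfun_cst.
- apply: bounded_mfunB; first exact: bounded_mfun_cst.
  by apply: bounded_mfunM => //; exact: bounded_mfun_cst.
Qed.

(** [A j + A k] is copied c times, one copy per label, which is why each score carries the slope 2 c
    L. The sign of [h j z y - h k z y] decides which of j, k enters the maximum with the plus
    sign. *)
Lemma pair_le_signed_max A j k z :
  A j + A k + 2 * L * \sum_y `|h j z y - h k z y| <=
  c%:R^-1 * \sum_y signed_max A y z.
Proof.
have cR : 0 < c%:R :> R by rewrite ltr0n.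
rewrite ler_pdivlMl// mulrDr !mulr_sumr.
have -> : c%:R * (A j + A k) = \sum_(y < c) (A j + A k).
  by rewrite sumr_const card_ord mulr_natl.
rewrite -big_split/=; apply: ler_sum => y _.
have sm i i' : A i + 2 * c%:R * L * h i z y + (A i' - 2 * c%:R * L * h i' z y) <=
    signed_max A y z.
  by apply: lerD; [exact: (fmax_ge (fun j => A j + _) i)|
                   exact: (fmax_ge (fun j => A j - _) i')].
have [_|_] := ger0P (h j z y - h k z y).
- by apply: le_trans (sm j k); rewrite le_eqVlt; apply/predU1P; left; ring.
- by apply: le_trans (sm k j); rewrite le_eqVlt; apply/predU1P; left; ring.
Qed.

(* One summand of the empirical process is symmetrized with a ghost copy and then
   contracted: for the two maximizers j, k the Lipschitz bound leaves the l1-distance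
   of their scores, each coordinate of which is a difference of signed maxima. *)
Lemma symmetrize_contract (A : 'I_m.+1 -> R) :
  \int[mu]_z fmax (fun j => A j + (\int[mu]_z l j z - l j z)) <=
  \int[mu]_z ((2 * c%:R)^-1 * \sum_y signed_max A y z).
Proof.
have bA j : bounded_mfun (fun _ : T => A j) by exact: bounded_mfun_cst.
pose G (p : T * T) := fmax (fun j => A j + (l j p.2 - l j p.1)).
have bG : bounded_mfun G.
  apply: bounded_mfun_fmax => j; apply: bounded_mfunD; first exact: bounded_mfun_cst.
  by apply: bounded_mfunB; exact: (bounded_mfun_comp (bl j)).
have bG1 z : bounded_mfun (fun z' => G (z, z')) by exact: bounded_mfun_pair1.
have bG2 z : bounded_mfun (fun z' => G (z', z)) by exact: bounded_mfun_pair2.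
pose M z := c%:R^-1 * \sum_y signed_max A y z.
have bM : bounded_mfun M.
  apply: bounded_mfunM; first exact: bounded_mfun_cst.
  by apply: bounded_mfun_sum => y; exact: bounded_mfun_signed_max.
(* Jensen: a ghost point [z'] stands for the inner expectation, and a maximum of integrals is at
   most the integral of the maximum. *)
have le1 : \int[mu]_z fmax (fun j => A j + (\int[mu]_z l j z - l j z)) <=
    \int[mu]_z \int[mu]_z' G (z, z').
  apply: le_Rintegral_bounded.
  - apply: bounded_mfun_fmax => j; apply: bounded_mfunD => //.
    by apply: bounded_mfunB => //; exact: bounded_mfun_cst.
  - exact: (bounded_mfun_Rintegral2 mu mu bG).
  move=> z; apply: fmax_le => j.
  have bz : bounded_mfun (fun z' => A j + (l j z' - l j z)).
    apply: bounded_mfunD => //; apply: bounded_mfunB => //; exact: bounded_mfun_cst.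
  have -> : A j + (\int[mu]_z l j z - l j z) = \int[mu]_z' (A j + (l j z' - l j z)).
    have bc r : bounded_mfun (fun=> r : R) by exact: bounded_mfun_cst.
    by rewrite RintegralD_bounded ?RintegralB_bounded ?Rintegral_prob_cst//; exact: bounded_mfunB.
  by apply: le_Rintegral_bounded => // z'; exact: (fmax_ge (fun j => A j + (l j z' - l j z))).
apply: le_trans le1 _.
have bF1 := bounded_mfun_Rintegral2 mu mu bG.
have bF2 := bounded_mfun_Rintegral1 mu mu bG.
(* Point and ghost are exchangeable, so [G (z, z')] may be estimated jointly with [G (z', z)]. *)
have swap : \int[mu]_z \int[mu]_z' G (z, z') = \int[mu]_z \int[mu]_z' G (z', z).
  by rewrite -(Rintegral_prod12 _ _ bG) (Rintegral_prod21 _ _ bG).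
have bc r : bounded_mfun (fun _ : T => r : R) by exact: bounded_mfun_cst.
have dbl : 2 * \int[mu]_z \int[mu]_z' G (z, z') <= \int[mu]_z M z.
  rewrite mulr_natl mulr2n {2}swap -RintegralD_bounded//.
  have -> : \int[mu]_z M z = \int[mu]_z (2^-1 * M z + 2^-1 * \int[mu]_z M z).
    rewrite RintegralD_bounded ?Rintegral_prob_cst//; last exact: bounded_mfunM.
    by rewrite (RintegralZl_bounded mu 2^-1 bM) -mulrDl [X in X * _](_ : _ = 1) ?mul1r//; lra.
  apply: le_Rintegral_bounded; first exact: bounded_mfunD.
    by apply: bounded_mfunD => //; exact: bounded_mfunM.
  move=> z; rewrite -RintegralD_bounded//.
  have -> : 2^-1 * M z + 2^-1 * \int[mu]_z M z = \int[mu]_z' (2^-1 * M z + 2^-1 * M z').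
    rewrite RintegralD_bounded ?Rintegral_prob_cst ?(RintegralZl_bounded mu 2^-1 bM)//.
    exact: bounded_mfunM.
  apply: le_Rintegral_bounded; first exact: bounded_mfunD.
    by apply: bounded_mfunD => //; exact: bounded_mfunM.
  move=> z'; rewrite /G/=.
  have [j ->] := fmax_attained (fun j => A j + (l j z' - l j z)).
  have [k ->] := fmax_attained (fun j => A j + (l j z - l j z')).
  (* The losses are regrouped by point, as l_j - l_k at [z'] and l_k - l_j at [z]; half of
     [A j + A k] is allotted to each point. *)
  have := pair_le_signed_max A j k z'; have := pair_le_signed_max A k j z.
  rewrite -/(M z) -/(M z'); have := lip z' j k; have := lip z k j.
  by lra.
have -> : \int[mu]_z ((2 * c%:R)^-1 * \sum_y signed_max A y z) = 2^-1 * \int[mu]_z M z.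
  rewrite -(RintegralZl_bounded mu 2^-1 bM); apply: eq_Rintegral => z _.
  by rewrite /M mulrA invfM.
by lra.
Qed.

End symmetrization.

Section deviation.
Context {R : realType} {dT : measure_display} {T : measurableType dT}.
Variable mu : probability T R.

(** Left unnormalized, so that a new sample point adds one summand and changes nothing else. *)
Definition deviation (f : T -> R) n (t : n.-tuple T) : R :=
  \sum_(i < n) (\int[mu]_z f z - f (tnth t i)).

Lemma deviation_tcons f n z (t : n.-tuple T) :
  deviation f (tcons (z, t)) = (\int[mu]_z f z - f z) + deviation f t.
Proof.
rewrite /deviation big_ord_recl tnth_tcons0; congr (_ + _).
by apply: eq_bigr => i _; rewrite tnth_tconsS.
Qed.

Lemma bounded_mfun_deviation f n :
  bounded_mfun f -> bounded_mfun (@deviation f n).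
Proof.
move=> bf; apply: bounded_mfun_sum => i; apply: bounded_mfunB; first exact: bounded_mfun_cst.
exact: (bounded_mfun_comp (bf) (measurable_tnth i)).
Qed.

End deviation.

Section linear_class.
Context {R : realType} {dT : measure_display} {T : measurableType dT}.
Variables (mu : probability T R) (m c : nat) (c_gt0 : (0 < c)%N) (I : finType).
Variables (w : 'I_m.+1 -> I -> R) (psi : 'I_c -> T -> I -> R).
Variables (l : 'I_m.+1 -> T -> R) (L B D : R).

Definition dot (u v : I -> R) : R := \sum_i u i * v i.

Hypotheses (bl : forall j, bounded_mfun (l j))
  (bpsi : forall y i, bounded_mfun (fun z => psi y z i))
  (lip : forall z j k, l j z - l k z <=
     L * \sum_y `|dot (w j) (psi y z) - dot (w k) (psi y z)|)
  (wB : forall j, dot (w j) (w j) <= B) (psiD : forall y z, dot (psi y z) (psi y z) <= D).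

Lemma dotDZ (a : R) (u v v' : I -> R) :
  dot u (fun i => v i + a * v' i) = dot u v + a * dot u v'.
Proof. by rewrite /dot mulr_sumr -big_split/=; apply: eq_bigr => i _; ring. Qed.

(** Young's inequality, from the square of s u - v. It trades the norm bound on the weights for the
    potential |v|^2 / (2 s), with s free until the end. *)
Lemma dot_le (s : R) (u v : I -> R) : 0 < s ->
  dot u v <= s / 2 * dot u u + dot v v / (2 * s).
Proof.
move=> s0; rewrite /dot mulr_sumr mulr_suml -big_split/=; apply: ler_sum => i _.
rewrite -subr_ge0.
have -> : s / 2 * (u i * u i) + v i * v i / (2 * s) - u i * v i =
  (s * u i - v i) ^+ 2 / (2 * s) by field; rewrite gt_eqF.
by rewrite divr_ge0 ?sqr_ge0// mulr_ge0// ltW.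
Qed.

(* Regularization replaces the norm constraint on the weights: the squared norm of the
   accumulated vector v is a potential that each sample increases by at most
   (2 c L)^2 D / 2 s on average, because the two signs cancel the cross term. *)
Lemma expected_deviation_potential (s : R) n (v : I -> R) : 0 < s ->
  \int[iid mu n]_t fmax (fun j => dot (w j) v + deviation mu (l j) t) <=
  s / 2 * B + (dot v v + n%:R * ((2 * c%:R * L) ^+ 2 * D)) / (2 * s).
Proof.
move=> s0; set K := 2 * c%:R * L.
have bmax k (A : 'I_m.+1 -> R) :
    bounded_mfun (fun t : k.-tuple T => fmax (fun j => A j + deviation mu (l j) t)).
  apply: bounded_mfun_fmax => j; apply: bounded_mfunD; first exact: bounded_mfun_cst.
  exact: bounded_mfun_deviation.
elim: n v => [|n ih] v.
  rewrite Rintegral_iid0//; apply: fmax_le => j.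
  rewrite /deviation big_ord0 addr0 mul0r addr0.
  apply: le_trans (dot_le _ _ s0) _; rewrite lerD2r.
  by rewrite ler_wpM2l// divr_ge0// ltW.
rewrite Rintegral_iidS//.
have bt := bounded_mfun_comp (bmax n.+1 (fun j => dot (w j) v)) (@measurable_tcons _ T n).
rewrite (Rintegral_prod21 _ _ bt) /=.
pose h j z y := dot (w j) (psi y z).
have bh j y : bounded_mfun (fun z => h j z y).
  by apply: bounded_mfun_sum => i; apply: bounded_mfunM => //; exact: bounded_mfun_cst.
pose F (p : T * n.-tuple T) := (2 * c%:R)^-1 *
  \sum_y signed_max h L (fun j => dot (w j) v + deviation mu (l j) p.2) y p.1.
have bF : bounded_mfun F.
  apply: bounded_mfunM; first exact: bounded_mfun_cst.
  apply: bounded_mfun_sum => y; rewrite /signed_max.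
  have b1 j : bounded_mfun (fun p : T * n.-tuple T => dot (w j) v + deviation mu (l j) p.2).
    apply: bounded_mfunD; first exact: bounded_mfun_cst.
    exact: (bounded_mfun_comp (bounded_mfun_deviation mu n (bl j))).
  have b2 j : bounded_mfun (fun p : T * n.-tuple T => 2 * c%:R * L * h j p.1 y).
    apply: bounded_mfunM; first exact: bounded_mfun_cst.
    exact: (bounded_mfun_comp (bh j y)).
  by apply: bounded_mfunD; apply: bounded_mfun_fmax => j;
    [exact: bounded_mfunD|exact: bounded_mfunB].
apply: (@le_trans _ _ (\int[iid mu n]_t \int[mu]_z F (z, t))).
  apply: le_Rintegral_bounded.
  - exact: (bounded_mfun_Rintegral1 mu (iid mu n) bt).
  - exact: (bounded_mfun_Rintegral1 mu (iid mu n) bF).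
  move=> t; have H := symmetrize_contract mu c_gt0 bl bh lip
    (fun j => dot (w j) v + deviation mu (l j) t).
  apply: le_trans H.
  rewrite le_eqVlt; apply/predU1P; left; apply: eq_Rintegral => z _; congr fmax; apply/funext => j.
  by rewrite deviation_tcons; ring.
(* The tail is now integrated first, with [z] fixed: the shifted vectors are then constants to which
   the induction hypothesis applies. *)
rewrite -(Rintegral_prod21 _ _ bF) (Rintegral_prod12 _ _ bF).
apply: Rintegral_bounded_le; first exact: (bounded_mfun_Rintegral2 mu (iid mu n) bF).
move=> z; rewrite /F/=.
(* By linearity, each sign of the score amounts to moving v by plus or minus K psi; this is why the
   induction carries an arbitrary v. *)
have split_pm y (t : n.-tuple T) :
   signed_max h L (fun j => dot (w j) v + deviation mu (l j) t) y z =
   fmax (fun j => dot (w j) (fun i => v i + K * psi y z i) + deviation mu (l j) t) +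
   fmax (fun j => dot (w j) (fun i => v i + - K * psi y z i) + deviation mu (l j) t).
  rewrite /signed_max; congr +%R; congr fmax; apply/funext => j; rewrite dotDZ /h -/K; ring.
under eq_Rintegral do under eq_bigr do rewrite split_pm.
rewrite RintegralZl_bounded; last first.
  by apply: bounded_mfun_sum => y; apply: bounded_mfunD; exact: bmax.
rewrite Rintegral_sum_bounded; last by move=> y; apply: bounded_mfunD; exact: bmax.
have cR : 0 < c%:R :> R by rewrite ltr0n.
rewrite ler_pdivrMl ?mulr_gt0//.
set b := (X in _ <= _ * X).
have -> : 2 * c%:R * b = \sum_(y < c) (2 * b).
  by rewrite sumr_const card_ord -mulr_natl; ring.
apply: ler_sum => y _; rewrite RintegralD_bounded//.
apply: le_trans (lerD (ih _) (ih _)) _.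
have dotE (a : R) : dot (fun i => v i + a * psi y z i) (fun i => v i + a * psi y z i) =
   dot v v + 2 * a * dot v (psi y z) + a ^+ 2 * dot (psi y z) (psi y z).
  rewrite /dot !mulr_sumr -!big_split/=; apply: eq_bigr => i _; ring.
rewrite !dotE /b -[n.+1%:R]natr1.
set q := dot (psi y z) (psi y z); have qD : q <= D by exact: psiD.
have Kq : K ^+ 2 * q <= K ^+ 2 * D by rewrite ler_wpM2l// sqr_ge0.
rewrite -subr_ge0.
(* The cross terms of the two signs cancel; what remains is the slack between K^2 D and K^2 q. *)
have -> : forall x x' X d e : R, 2 * (x + (X + (x' + 1) * e) / (2 * s)) -
  (x + (X + 2 * K * d + K ^+ 2 * q + x' * e) / (2 * s) +
  (x + (X + 2 * - K * d + (- K) ^+ 2 * q + x' * e) / (2 * s))) = (e - K ^+ 2 * q) / s.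
  by move=> *; field; rewrite gt_eqF.
by rewrite divr_ge0 ?subr_ge0// ltW.
Qed.

End linear_class.

Section uniform_deviation.
Context {R : realType} {dT : measure_display} {T : measurableType dT}.
Variable mu : probability T R.

Lemma unit_differences_deviation (f : T -> R) n (i : 'I_n) (t t' : n.-tuple T) :
  (forall z, 0 <= f z <= 1) -> (forall j, j != i -> tnth t j = tnth t' j) ->
  deviation mu f t - deviation mu f t' <= 1.
Proof.
move=> f01 tt'; rewrite /deviation -sumrB (bigD1 i)//= big1 => [|j ji].
  by rewrite addr0; have := f01 (tnth t i); have := f01 (tnth t' i); lra.
by rewrite (tt' j ji) subrr.
Qed.

(** The first term bounds the mean of the maximal deviation; the second is the u with exp (- 2 u^2 /
    n) = delta. *)
Definition deviation_bound (c n : nat) (L r b delta : R) : R :=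
  3 * c%:R * L * r * b * Num.sqrt n%:R + Num.sqrt (n%:R / 2 * ln (1 / delta)).

Lemma finite_class_deviation (m c n : nat) (I : finType)
    (w : 'I_m.+1 -> I -> R) (psi : 'I_c -> T -> I -> R) (l : 'I_m.+1 -> T -> R)
    (L r b delta : R) : (0 < c)%N -> (0 < n)%N -> 0 < L -> 0 < r -> 0 < b ->
  0 < delta < 1 ->
  (forall j, bounded_mfun (l j)) -> (forall j z, 0 <= l j z <= 1) ->
  (forall y i, bounded_mfun (fun z => psi y z i)) ->
  (forall z j k, l j z - l k z <=
     L * \sum_y `|dot (w j) (psi y z) - dot (w k) (psi y z)|) ->
  (forall j, dot (w j) (w j) <= b ^+ 2) ->
  (forall y z, dot (psi y z) (psi y z) <= 2 * r ^+ 2) ->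
  (iid mu n [set t | exists j, (deviation_bound c n L r b delta < deviation mu (l j) t)%R]
     <= delta%:E)%E.
Proof.
move=> c0 n0 L0 r0 b0 /andP[d0 d1] bl l01 bpsi lip wb psir.
pose F (t : n.-tuple T) := fmax (fun j => deviation mu (l j) t).
have bF : bounded_mfun F by apply: bounded_mfun_fmax => j; exact: bounded_mfun_deviation.
have cR : 0 < c%:R :> R by rewrite ltr0n.
have nR : 0 < n%:R :> R by rewrite ltr0n.
have sn0 : 0 < Num.sqrt n%:R :> R by rewrite sqrtr_gt0.
pose K := 2 * c%:R * L; have K0 : 0 < K by rewrite /K !mulr_gt0.
(* The optimal parameter up to a factor sqrt 2; the potential bound becomes (1/2 + 1) K r b sqrt n,
   whence the constant 3 c L. *)
pose s := K * r * Num.sqrt n%:R / b; have s0 : 0 < s by rewrite /s divr_gt0// !mulr_gt0.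
have EF : \int[iid mu n]_t F t <= 3 * c%:R * L * r * b * Num.sqrt n%:R.
  have := expected_deviation_potential mu c0 bl bpsi lip wb psir n (fun=> 0) s0.
  rewrite -/K (_ : dot (fun=> 0) (fun=> 0) = 0) ?add0r; last first.
    by rewrite /dot big1// => i _; rewrite mulr0.
  rewrite (_ : (fun t => _) = F); last first.
    apply/funext => t; rewrite /F; congr fmax; apply/funext => j.
    by rewrite /dot big1 ?add0r// => i _; rewrite mulr0.
  move=> /le_trans; apply; rewrite le_eqVlt; apply/predU1P; left.
  rewrite -[X in X * (_ * _)](sqr_sqrtr (ltW nR)) /s /K; field.
  by rewrite !gt_eqF.
have dF : unit_differences F.
  move=> i t t' tt'; rewrite lerBlDr; apply: fmax_le => j.
  have := unit_differences_deviation (l01 j) tt'.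
  have := fmax_ge (fun j => deviation mu (l j) t') j; rewrite -/(F t').
  by lra.
have ln0 : 0 <= ln (1 / delta) by apply: ln_ge0; rewrite ler_pdivlMr// mul1r ltW.
set u := Num.sqrt (n%:R / 2 * ln (1 / delta)).
have u0 : 0 <= u by exact: sqrtr_ge0.
have := mcdiarmid mu n0 bF dF u0.
have -> : - (2 * u ^+ 2 / n%:R) = ln delta.
  rewrite sqr_sqrtr; last by rewrite mulr_ge0// divr_ge0// ltW.
  by rewrite div1r lnV ?posrE//; field; rewrite gt_eqF.
rewrite lnK ?posrE//; apply: le_trans.
have mF (a : R) : measurable [set t | (a <= F t)%R] /\ measurable [set t | (a < F t)%R].
  rewrite (_ : [set t | _] = F @^-1` `[a, +oo[); last first.
    by apply/seteqP; split => t /=; rewrite in_itv/= andbT.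
  rewrite (_ : [set t | _] = F @^-1` `]a, +oo[); last first.
    by apply/seteqP; split => t /=; rewrite in_itv/= andbT.
  by split; rewrite -[X in measurable X]setTI; exact: bF.1.
have -> : [set t | exists j, (deviation_bound c n L r b delta < deviation mu (l j) t)%R] =
   [set t | (deviation_bound c n L r b delta < F t)%R].
  apply/seteqP; split => t /=.
    by move=> [j /lt_le_trans]; apply; exact: (fmax_ge (fun j => deviation mu (l j) t)).
  by rewrite /F; have [j ->] := fmax_attained (fun j => deviation mu (l j) t) => ?; exists j.
apply: le_measure; rewrite ?inE; [exact: (mF _).2|exact: (mF _).1|].
move=> t /= /ltW; apply: le_trans; rewrite /deviation_bound -/u.
by rewrite lerD2r.
Qed.

(** The event is the increasing union of those of the initial segments of the class, all bounded by
    the same delta; continuity from below concludes. *)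
Lemma countable_class_deviation (n : nat) (l : nat -> T -> R) (a delta : R) :
  (forall j, bounded_mfun (l j)) ->
  (forall m, (iid mu n [set t | exists j : 'I_m.+1, (a < deviation mu (l j) t)%R]
     <= delta%:E)%E) ->
  measurable [set t : n.-tuple T | exists j, (a < deviation mu (l j) t)%R] /\
  (iid mu n [set t | exists j, (a < deviation mu (l j) t)%R] <= delta%:E)%E.
Proof.
move=> bl fin.
pose B m := [set t : n.-tuple T | exists j : 'I_m.+1, (a < deviation mu (l j) t)%R].
have mB1 j : measurable [set t : n.-tuple T | (a < deviation mu (l j) t)%R].
  rewrite (_ : [set t | _] = deviation mu (l j) (n := n) @^-1` `]a, +oo[); last first.
    by apply/seteqP; split => t /=; rewrite in_itv/= andbT.
  by rewrite -[X in measurable X]setTI; exact: (bounded_mfun_deviation mu n (bl j)).1.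
have mB m : measurable (B m).
  rewrite (_ : B m = \bigcup_(j in [set: 'I_m.+1]) [set t | (a < deviation mu (l j) t)%R]).
    exact: fin_bigcup_measurable.
  by apply/seteqP; split => t /= [j]; [exists j|exists j].
have UB : [set t : n.-tuple T | exists j, (a < deviation mu (l j) t)%R] = \bigcup_m B m.
  apply/seteqP; split => t /=; first by move=> [j tj]; exists j => //; exists ord_max.
  by move=> [m _ [j tj]]; exists j.
rewrite UB; split; first exact: bigcup_measurable.
have ndB : nondecreasing_seq B.
  move=> p q pq; apply/subsetPset => t [j tj].
  by exists (widen_ord (pq : (p.+1 <= q.+1)%N) j).
have cvB := nondecreasing_cvg_mu (mu := iid mu n) mB
  (bigcup_measurable (fun k _ => mB k)) ndB.
have /cvg_lim <-// := cvB; apply: lime_le.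
  by apply/cvg_ex; eexists; exact: cvB.
by apply: nearW => m; exact: fin.
Qed.

End uniform_deviation.

(** * Margin losses *)

Section margin.
Context {R : realType}.
Implicit Types (g : nat -> R) (gamma : R).

Lemma ramp_ge0_le1 (x : R) : 0 <= ramp x <= 1.
Proof. by rewrite /ramp le_min ler01 le_max lexx ge_min lexx. Qed.

Lemma ramp_lipschitz (x y : R) : ramp x - ramp y <= `|x - y|.
Proof.
rewrite /ramp; case: (leP 0 (1 - x)) => ?; case: (leP 0 (1 - y)) => ?.
- by case: (leP 1 (1 - x)) => ?; case: (leP 1 (1 - y)) => ?; have [?|?] := ger0P (x - y); lra.
- by case: (leP 1 (1 - x)) => ?; case: (leP 1 0) => ?; have [?|?] := ger0P (x - y); lra.
- by case: (leP 1 0) => ?; case: (leP 1 (1 - y)) => ?; have [?|?] := ger0P (x - y); lra.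
- by case: (leP 1 0) => ?; have [?|?] := ger0P (x - y); lra.
Qed.

Lemma ramp_le (x : R) : x <= 1 -> ramp x <= 1 - x.
Proof. by move=> x1; rewrite /ramp ge_min ge_max lexx andbT subr_ge0 x1 orbT. Qed.

Lemma ramp_le0 (x : R) : x <= 0 -> ramp x = 1.
Proof.
move=> x0; rewrite /ramp; apply/min_idPl; rewrite le_max; apply/orP; right; lra.
Qed.

Lemma max_other_ge c g y y' : (y' < c)%N -> y' != y -> g y' <= max_other c g y.
Proof.
move=> y'c y'y; rewrite /max_other.
exact: (le_bigmax_cond _ (fun i : 'I_c => g i) (j := Ordinal y'c)).
Qed.

Lemma max_other_attained c g y : (1 < c)%N ->
  exists y', [/\ (y' < c)%N, y' != y & max_other c g y = g y'].
Proof.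
move=> c1; rewrite /max_other; elim/big_ind : _ => [|a b|i iy].
- by case: y => [|y]; [exists 1%N|exists 0%N; rewrite ltnW].
- move=> [i [? ? ->]] [j [? ? ->]].
  by case: (leP (g i) (g j)) => _; [exists j|exists i].
- by exists i.
Qed.

(** If k attains the competing maximum of g', that of g is at least [g k]; only the distinct
    coordinates y and k then matter. *)
Lemma margin_lipschitz c g g' y : (1 < c)%N -> (y < c)%N ->
  (g y - max_other c g y) - (g' y - max_other c g' y) <=
  \sum_(y' < c) `|g y' - g' y'|.
Proof.
move=> c1 yc; have [k [kc ky gk]] := max_other_attained g' y c1.
rewrite (bigD1 (Ordinal yc))//= (bigD1 (Ordinal kc))/=; last by rewrite -val_eqE.
have := max_other_ge g kc ky; rewrite gk.
have := ler_norm (g y - g' y); have := ler_norm (g' k - g k); rewrite distrC.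
have : 0 <= \sum_(i < c | (i != Ordinal yc) && (i != Ordinal kc)) `|g i - g' i|.
  exact: sumr_ge0.
by lra.
Qed.

(** A finite sum over labels instead of the score at a variable label: measurability is then checked
    label by label, and labels outside the range get loss 0. *)
Definition margin_loss (W : Type) c gamma (h : W -> nat -> R) (z : W * nat) : R :=
  \sum_(y < c) (z.2 == y)%:R * ramp ((h z.1 y - max_other c (h z.1) y) / gamma).

Lemma margin_lossE (W : Type) c gamma (h : W -> nat -> R) z : (z.2 < c)%N ->
  margin_loss c gamma h z = ramp ((h z.1 z.2 - max_other c (h z.1) z.2) / gamma).
Proof.
move=> zc; rewrite /margin_loss (bigD1 (Ordinal zc))//= eqxx mul1r big1 ?addr0// => i.
by rewrite -val_eqE/= eq_sym => /negbTE ->; rewrite mul0r.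
Qed.

Lemma margin_loss_out (W : Type) c gamma (h : W -> nat -> R) z : (c <= z.2)%N ->
  margin_loss c gamma h z = 0.
Proof.
move=> cz; rewrite /margin_loss big1// => i _; rewrite gtn_eqF ?mul0r//.
exact: leq_trans cz.
Qed.

Lemma margin_loss_ge0_le1 (W : Type) c gamma (h : W -> nat -> R) z :
  0 <= margin_loss c gamma h z <= 1.
Proof.
have [cz|zc] := leqP c z.2; first by rewrite margin_loss_out// lexx ler01.
by rewrite margin_lossE// ramp_ge0_le1.
Qed.

Lemma margin_loss_lipschitz (W : Type) c gamma (h h' : W -> nat -> R) z :
  (1 < c)%N -> 0 < gamma ->
  margin_loss c gamma h z - margin_loss c gamma h' z <=
  gamma^-1 * \sum_(y < c) `|h z.1 y - h' z.1 y|.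
Proof.
move=> c1 g0; have [cz|zc] := leqP c z.2.
  by rewrite !margin_loss_out// subrr mulr_ge0 ?invr_ge0 ?(ltW g0)// sumr_ge0.
rewrite !margin_lossE//; apply: le_trans (ramp_lipschitz _ _) _.
rewrite -mulrBl mulrC normrM gtr0_norm ?invr_gt0// ler_wpM2l ?invr_ge0 ?(ltW g0)//.
rewrite ler_norml margin_lipschitz// andbT lerNl opprB.
apply: le_trans (margin_lipschitz _ _ c1 zc) _.
by apply: ler_sum => i _; rewrite distrC.
Qed.

End margin.

Section margin_measurable.
Context {R : realType} {dW : measure_display} {W : measurableType dW}.

Lemma bounded_mfun_max_other c (h : W -> nat -> R) y :
  (forall y, bounded_mfun (h ^~ y)) -> bounded_mfun (fun x => max_other c (h x) y).
Proof.
move=> bh; rewrite /max_other; under eq_fun do rewrite -big_filter.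
exact: bounded_mfun_bigmax.
Qed.

Lemma bounded_mfun_margin_loss c gamma (h : W -> nat -> R) :
  (forall y, bounded_mfun (h ^~ y)) -> bounded_mfun (margin_loss c gamma h).
Proof.
move=> bh; apply: bounded_mfun_sum => y; apply: bounded_mfunM.
  split; last by exists 1 => z; rewrite ger0_norm//; case: (_ == _).
  rewrite (_ : (fun z => _) = \1_(snd @^-1` [set (y : nat)])).
    by apply: measurable_indic; rewrite -[X in measurable X]setTI; exact: measurable_snd.
  apply/funext => z; rewrite indicE; congr (nat_of_bool _)%:R.
  by apply/eqP/idP; rewrite inE.
pose G x := ramp ((h x y - max_other c (h x) y) / gamma).
suff bG : bounded_mfun G by exact: (bounded_mfun_comp bG measurable_fst).
have bc r : bounded_mfun (fun _ : W => r : R) by exact: bounded_mfun_cst.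
split; last first.
  exists 1 => x; have /andP[? ?] := ramp_ge0_le1 ((h x y - max_other c (h x) y) / gamma).
  by rewrite ger0_norm.
apply: measurable_minr => //; apply: measurable_maxr => //.
have [] // : bounded_mfun (fun x => 1 - (h x y - max_other c (h x) y) / gamma).
apply: bounded_mfunB => //; apply: bounded_mfunM => //; apply: bounded_mfunB => //.
exact: bounded_mfun_max_other.
Qed.

End margin_measurable.

Lemma sum_offdiag {V : zmodType} n (f : 'I_n -> 'I_n -> V) : (forall i, f i i = 0) ->
  \sum_(i < n) \sum_(j < n) f i j = \sum_(i < n) \sum_(j < n | (i < j)%N) (f i j + f j i).
Proof.
move=> fii; under [RHS]eq_bigr do rewrite big_split/=.
rewrite [RHS]big_split/= [X in _ = _ + X](exchange_big_dep predT)//= -big_split/=.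
apply: eq_bigr => i _; rewrite (bigID (fun j : 'I_n => (i < j)%N))/=; congr (_ + _).
rewrite (bigD1 i) ?ltnn//= fii add0r; apply: eq_bigl => j.
by rewrite -leqNgt ltn_neqAle andbC.
Qed.

(** * Empirical margin risk against average similarity *)

Section empirical_margin.
Context {R : realType} {d : nat}.
Variables (X : set (d.-tuple R)) (S : d.-tuple R -> d.-tuple R -> R).
Hypotheses (S01 : forall x t, X x -> X t -> 0 <= S x t <= 1)
  (Ssym : forall x t, X x -> X t -> S x t = S t x).

(** Scores lie in [0, 1], so [1 <= gamma] keeps the scaled margin at most 1, where the ramp is below
    1 - x. The bound thus becomes linear in the margins. *)
Lemma emp_risk_similarity_bound (n c : nat) (gamma : R) (xs : 'I_n -> d.-tuple R)
    (ys : 'I_n -> nat) (alpha : 'I_n -> R) : (1 < c)%N -> (0 < n)%N ->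
  (forall i, X (xs i) /\ (ys i < c)%N) ->
  (forall i, 0 <= alpha i) -> \sum_(i < n) alpha i = 1 -> 1 <= gamma ->
  emp_risk c gamma (hS S xs ys alpha) xs ys
        <= 1 - (n%:R * gamma)^-1 *
               \sum_(i < n) \sum_(j < n) (alpha i + alpha j) / 2 * S (xs i) (xs j)
             + (n%:R * gamma)^-1 *
               \sum_(i < n) \sum_(j < n | (i < j)%N)
                  2 * (alpha i + alpha j) * S (xs i) (xs j) * (ys i != ys j)%:R.
Proof.
move=> c1 n0 Xxs a0 a1 g1.
have g0 : 0 < gamma by exact: lt_le_trans g1.
have nR : 0 < n%:R :> R by rewrite ltr0n.
pose s i j := S (xs i) (xs j).
have s0 i j : 0 <= s i j by have /andP[] := S01 (Xxs i).1 (Xxs j).1.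
have s1 i j : s i j <= 1 by have /andP[] := S01 (Xxs i).1 (Xxs j).1.
have ssym i j : s i j = s j i by exact: Ssym (Xxs i).1 (Xxs j).1.
pose h := hS S xs ys alpha.
have h0 i y : 0 <= h (xs i) y.
  by apply: sumr_ge0 => j _; apply: mulr_ge0; [exact: a0|exact: s0].
have h1 i y : h (xs i) y <= 1.
  rewrite -a1 /h /hS big_mkcond/=; apply: ler_sum => j _.
  by case: ifP => // _; apply: ler_piMr; [exact: a0|exact: s1].
pose rho i := h (xs i) (ys i) - max_other c (h (xs i)) (ys i).
have rho1 i : rho i / gamma <= 1.
  rewrite ler_pdivrMr// mul1r; apply: le_trans g1.
  have [k [_ _ E]] := max_other_attained (h (xs i)) (ys i) c1.
  by rewrite /rho E; have := h0 i k; have := h1 i (ys i); lra.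
have step1 : emp_risk c gamma h xs ys <= 1 - (n%:R * gamma)^-1 * \sum_i rho i.
  rewrite /emp_risk ler_pdivrMl//.
  have -> : n%:R * (1 - (n%:R * gamma)^-1 * \sum_i rho i) = \sum_i (1 - rho i / gamma).
    by rewrite [RHS]sumrB sumr_const card_ord -mulr_suml; field; rewrite !gt_eqF.
  by apply: ler_sum => i _; apply: ramp_le; exact: rho1.
apply: le_trans step1 _.
(* The best competitor is enlarged to all other labels together: same-label mass minus other-label
   mass is total mass minus twice the latter. *)
have rho_ge i : \sum_j alpha j * s i j - \sum_j 2 * alpha j * s i j * (ys i != ys j)%:R <= rho i.
  have [k [_ ki E]] := max_other_attained (h (xs i)) (ys i) c1.
  rewrite /rho E /h /hS -sumrB [X in _ <= X - _]big_mkcond [X in _ <= _ - X]big_mkcond -sumrB/=.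
  apply: ler_sum => j _; rewrite -/(s i j) [ys i == _]eq_sym.
  have := mulr_ge0 (a0 j) (s0 i j); case: eqVneq => [->|_] /=.
    by rewrite eq_sym (negbTE ki); lra.
  by case: ifP => _; lra.
have A_eq : \sum_i \sum_j (alpha i + alpha j) / 2 * s i j = \sum_i \sum_j alpha j * s i j.
  have -> : \sum_i \sum_j alpha j * s i j =
      2^-1 * (\sum_i \sum_j alpha j * s i j + \sum_i \sum_j alpha i * s i j).
    rewrite [X in _ * (_ + X)]exchange_big/=.
    have -> : \sum_i \sum_j alpha j * s j i = \sum_i \sum_j alpha j * s i j.
      by apply: eq_bigr => i _; apply: eq_bigr => j _; rewrite ssym.
    lra.
  rewrite -big_split mulr_sumr/=; apply: eq_bigr => i _.
  by rewrite -big_split mulr_sumr/=; apply: eq_bigr => j _; field.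
have B_eq : \sum_(i < n) \sum_(j < n | (i < j)%N)
      2 * (alpha i + alpha j) * s i j * (ys i != ys j)%:R =
    \sum_i \sum_j 2 * alpha j * s i j * (ys i != ys j)%:R.
  rewrite [RHS]sum_offdiag => [|i]; last by rewrite eqxx mulr0.
  apply: eq_bigr => i _; apply: eq_bigr => j _.
  by rewrite (ssym j i) (eq_sym (ys j)); ring.
rewrite -/s.
have := ler_sum (index_enum 'I_n) (fun i (_ : true) => rho_ge i).
rewrite sumrB -A_eq -B_eq => /(ler_wpM2l (_ : 0 <= (n%:R * gamma)^-1)) /=.
by rewrite invr_ge0 mulr_ge0 ?(ltW nR) ?(ltW g0)// => /(_ isT); rewrite mulrBr; lra.
Qed.

End empirical_margin.

(** * Measurability *)

Section compact_measurable.
Context {R : realType} {d : nat}.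

Definition tuple_ball (q : d.-tuple R) (e : R) : set (d.-tuple R) :=
  [set t | forall i, `|tnth q i - tnth t i| < e].

Lemma measurable_tuple_ball q e : measurable (tuple_ball q e).
Proof.
rewrite (_ : tuple_ball q e = tuple_rect (fun i => [set x | `|tnth q i - x| < e])).
  apply: measurable_tuple_rect => i.
  rewrite (_ : [set x | _] = ball (tnth q i) e); first exact: measurable_ball.
  by apply/seteqP; split.
by apply/seteqP; split => t /= H i; [move=> _|]; exact: H.
Qed.

(* A closed X is the intersection over k of the union of the rational balls of
   radius 1/(k+1) that meet X. *)
Lemma compact_tup_measurable (X : set (d.-tuple R)) : compact_tup X -> measurable X.
Proof.
move=> cX; have clX : closed (@vec_of_tuple R d @` X).
  by apply: compact_closed => //; exact: norm_hausdorff.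
pose qt (q : d.-tuple rat) : d.-tuple R := [tuple ratr (tnth q i) | i < d].
pose U k := \bigcup_(q in [set q : d.-tuple rat | tuple_ball (qt q) k.+1%:R^-1 `&` X !=set0])
   tuple_ball (qt q) k.+1%:R^-1.
have mU k : measurable (U k).
  rewrite /U bigcup_mkcond; apply: countable_bigcupT_measurable => //.
  by move=> q; case: ifP => // _; exact: measurable_tuple_ball.
rewrite (_ : X = \bigcap_k U k); first exact: bigcapT_measurable.
apply/seteqP; split => t.
  move=> Xt k _.
  have e0 : 0 < (k.+1%:R^-1 : R) by rewrite invr_gt0.
  have qex i : exists q : rat, `|ratr q - tnth t i| < k.+1%:R^-1.
    have lt_t : tnth t i < tnth t i + k.+1%:R^-1 by rewrite ltrDl.
    have [q /itvP qi] := rat_in_itvoo lt_t; exists q.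
    rewrite ger0_norm ?subr_ge0 ?qi// ltrBlDl.
    by rewrite qi.
  have [q tq] := choice qex.
  have tball : tuple_ball (qt [tuple q i | i < d]) k.+1%:R^-1 t.
    by move=> i; rewrite !tnth_mktuple.
  by exists [tuple q i | i < d] => //; exists t.
move=> Ut; have : closure (@vec_of_tuple R d @` X) (vec_of_tuple t).
  move=> B /nbhs_ballP[e /= e0 eB].
  (* A rational center this close to both [t] and a point of X puts that point within e of [t]. *)
  have [k ke] : exists k : nat, k.+1%:R^-1 < e / 2.
    exists (Num.truncn (e / 2)^-1); rewrite invf_plt ?posrE ?divr_gt0//.
    exact: truncnS_gt.
  have [q [x [xq Xx]] tq] := Ut k Logic.I.
  exists (vec_of_tuple x); split; first by exists x.
  apply: eB; split => // i j; rewrite /ball/= !mxE.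
  have := ler_distD (tnth (qt q) j) (tnth t j) (tnth x j).
  have := xq j; have := tq j; rewrite (distrC _ (tnth t j)) => tqj xqj.
  move=> /le_lt_trans; apply; rewrite (splitr e); apply: ltrD; exact: lt_trans ke.
move=> /clX [x Xx /matrixP xt]; rewrite (_ : t = x)//.
by apply: eq_from_tnth => i; have := xt ord0 i; rewrite !mxE.
Qed.

End compact_measurable.

Section argmax_measurable.
Context {R : realType} {d : nat}.

(** The classifier depends on x only through the finite table [B x] of comparisons between scores,
    and each table is taken on a measurable part of X. *)
Lemma measurable_fS_neq c (y0 : 'I_c) (X : set (d.-tuple R)) (h : d.-tuple R -> nat -> R) :
  measurable X -> (forall y, (y < c)%N -> measurable_fun X (h ^~ y)) ->
  measurable [set z : d.-tuple R * nat | X z.1 /\ z.2 != fS y0 h z.1].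
Proof.
move=> mX mh.
pose B x := [ffun p : 'I_c * 'I_c => h x p.2 <= h x p.1].
pose F (M : {ffun 'I_c * 'I_c -> bool}) : nat := odflt y0 [pick i | [forall j, M (i, j)]].
have fSE x : fS y0 h x = F (B x).
  rewrite /fS /Order.arg_max /extremum /F; congr (nat_of_ord (odflt _ _)).
  by apply: eq_pick => i /=; apply: eq_forallb => j; rewrite ffunE.
have mB M : measurable (X `&` [set x | B x = M]).
  rewrite (_ : _ `&` _ = \bigcap_(p in [set: 'I_c * 'I_c])
      (X `&` (fun x => h x p.2 <= h x p.1) @^-1` [set M p])).
    apply: fin_bigcap_measurable => //.
    by move=> p _; apply: measurable_fun_ler => //; exact: mh.
  apply/seteqP; split => x /=.
    by move=> [Xx <-] p _ /=; rewrite ffunE.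
  move=> H; split; first by have [] := H (y0, y0) Logic.I.
  by apply/ffunP => p; rewrite ffunE; have [] := H p Logic.I.
rewrite (_ : [set z | _] = \bigcup_k
   ((\bigcup_(M in [set M | k != F M]) (X `&` [set x | B x = M])) `*` [set k])).
  apply: bigcup_measurable => k _; apply: measurableX => //.
  by apply: fin_bigcup_measurable => //; exact: finite_finpred.
apply/seteqP; split => -[x k] /=.
  move=> [Xx]; rewrite fSE => kF; exists k => //; split => //=.
  by exists (B x).
by move=> [k' _ [/= [M kM [Xx BM]] kk']]; rewrite fSE BM kk'.
Qed.

End argmax_measurable.

(** * Spectral features and countable weights *)

Lemma cvg_finsum {R : realType} (I : Type) (r : seq I) (P : pred I)
    (F : I -> nat -> R) (a : I -> R) :
  (forall i, P i -> F i n @[n --> \oo] --> a i) ->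
  \sum_(i <- r | P i) F i n @[n --> \oo] --> \sum_(i <- r | P i) a i.
Proof.
move=> Fa; elim: r => [|i r ih].
  under eq_fun do rewrite big_nil.
  by rewrite big_nil; exact: cvg_cst.
under eq_fun do rewrite big_cons.
by rewrite big_cons; case: ifP => // Pi; apply: cvgD => //; exact: Fa.
Qed.

Section spectral_features.
Context {R : realType} {d : nat}.
Variables (X : set (d.-tuple R)) (S : d.-tuple R -> d.-tuple R -> R)
  (lam : nat -> R) (phi : nat -> d.-tuple R -> R) (r : R).

(** With these features S is the indefinite form with signs [spectral_sign], while S^+ + S^- is the
    ordinary inner product. *)
Definition spectral_feature k x : R := Num.sqrt `|lam k| * phi k x.
Definition spectral_sign k : R := if 0 <= lam k then 1 else -1.

Local Notation psi := spectral_feature.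
Local Notation sg := spectral_sign.

Definition plus_part k x t : R := (0 <= lam k)%R%:R * (psi k x * psi k t).
Definition minus_part k x t : R := (lam k < 0)%R%:R * (psi k x * psi k t).

Lemma spectral_featureM k x t : psi k x * psi k t = `|lam k| * phi k x * phi k t.
Proof.
by rewrite /psi mulrACA -expr2 sqr_sqrtr// mulrA.
Qed.

Lemma SplusE x t : Splus lam phi x t = limn (series (fun k => plus_part k x t)).
Proof.
congr (limn (series _)); apply/funext => k.
by rewrite /plus_part spectral_featureM; case: ger0P => _; rewrite ?mul1r ?mul0r.
Qed.

Lemma SminusE x t : Sminus lam phi x t = limn (series (fun k => minus_part k x t)).
Proof.
congr (limn (series _)); apply/funext => k.
by rewrite /minus_part spectral_featureM; case: ltP => _; rewrite ?mul1r ?mul0r.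
Qed.

Hypotheses
  (summable : forall x, X x -> cvgn (series (fun k => `|lam k| * phi k x ^+ 2)))
  (S_decomp : forall x t, X x -> X t -> S x t = Splus lam phi x t - Sminus lam phi x t)
  (hSp : forall x, X x -> `|Splus lam phi x x| <= r ^+ 2)
  (hSm : forall x, X x -> `|Sminus lam phi x x| <= r ^+ 2).

(** Absolute convergence by |a b| <= a^2 + b^2 and the two diagonal series. The selection [e] covers
    both signs of the eigenvalues. *)
Lemma cvg_series_features (e : nat -> bool) x t : X x -> X t ->
  cvgn (series (fun k => (e k)%:R * (psi k x * psi k t))).
Proof.
move=> Xx Xt; apply: normed_cvg.
have := is_cvg_seriesD (summable Xx) (summable Xt).
apply: series_le_cvg => k //=.
- by rewrite fctE addr_ge0// mulr_ge0// sqr_ge0.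
rewrite fctE spectral_featureM -mulrA.
have -> : forall a b c : R, a * b ^+ 2 + a * c ^+ 2 = a * (b ^+ 2 + c ^+ 2) by move=> *; ring.
have h1 : `|phi k x * phi k t| <= phi k x ^+ 2 + phi k t ^+ 2.
  have := sqr_ge0 (phi k x - phi k t); have := sqr_ge0 (phi k x + phi k t).
  have := sqr_ge0 (phi k x); have := sqr_ge0 (phi k t).
  by rewrite ler_norml; move=> *; apply/andP; split; nra.
rewrite normrM normrM normr_id; case: (e k).
  by rewrite normr1 mul1r ler_wpM2l.
by rewrite normr0 mul0r mulr_ge0// addr_ge0 ?sqr_ge0.
Qed.

Lemma cvg_Splus x t : X x -> X t ->
  series (fun k => plus_part k x t) @ \oo --> Splus lam phi x t.
Proof.
move=> Xx Xt; rewrite SplusE.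
exact: (cvg_series_features (e := fun k => 0 <= lam k) Xx Xt).
Qed.

Lemma cvg_Sminus x t : X x -> X t ->
  series (fun k => minus_part k x t) @ \oo --> Sminus lam phi x t.
Proof.
move=> Xx Xt; rewrite SminusE.
exact: (cvg_series_features (e := fun k => lam k < 0) Xx Xt).
Qed.

Lemma cvg_spectral x t : X x -> X t ->
  \sum_(k < K) sg k * psi k x * psi k t @[K --> \oo] --> S x t.
Proof.
move=> Xx Xt; rewrite S_decomp//.
rewrite (_ : (fun _ => _) = series (fun k => plus_part k x t) \-
    series (fun k => minus_part k x t)).
  by apply: cvgB; [exact: cvg_Splus|exact: cvg_Sminus].
apply/funext => K; rewrite !seriesEord/= -sumrB; apply: eq_bigr => k _.
rewrite /sg /plus_part /minus_part; case: ger0P => _; rewrite ?mul1r ?mul0r ?mulN1r ?subr0 ?sub0r//.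
by rewrite mulNr.
Qed.

(** Diagonal terms are nonnegative, so partial sums stay below S^+(x, x) + S^-(x, x); each part
    contributes one r^2. *)
Lemma sum_feature_sqr_le x K : X x -> \sum_(k < K) psi k x ^+ 2 <= 2 * r ^+ 2.
Proof.
move=> Xx.
have -> : \sum_(k < K) psi k x ^+ 2 =
    series (fun k => plus_part k x x) K + series (fun k => minus_part k x x) K.
  rewrite !seriesEord/= -big_split/=; apply: eq_bigr => k _.
  by rewrite /plus_part /minus_part -expr2; case: ger0P => _; rewrite ?mul1r ?mul0r ?addr0 ?add0r.
have part_ge0 (b : bool) k : 0 <= b%:R * (psi k x * psi k x).
  by rewrite -expr2 mulr_ge0 ?sqr_ge0.
have leP : series (fun k => plus_part k x x) K <= Splus lam phi x x.
  have cv := cvg_Splus Xx Xx; rewrite -(cvg_lim _ cv)//.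
  apply: nondecreasing_cvgn_le; first by apply: nondecreasing_series => k _ _; exact: part_ge0.
  by apply/cvg_ex; exists (Splus lam phi x x).
have leM : series (fun k => minus_part k x x) K <= Sminus lam phi x x.
  have cv := cvg_Sminus Xx Xx; rewrite -(cvg_lim _ cv)//.
  apply: nondecreasing_cvgn_le; first by apply: nondecreasing_series => k _ _; exact: part_ge0.
  by apply/cvg_ex; exists (Sminus lam phi x x).
have := ler_norm (Splus lam phi x x); have := ler_norm (Sminus lam phi x x).
have := hSp Xx; have := hSm Xx; lra.
Qed.

Section sample.
Variables (n c : nat) (xs : 'I_n -> d.-tuple R) (ys : 'I_n -> nat) (alpha : 'I_n -> R).
Hypothesis Xxs : forall i, X (xs i).

Definition label_feature y k : R := \sum_(i < n) alpha_lab alpha ys y i * psi k (xs i).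

Lemma Omega_cvg (part : nat -> d.-tuple R -> d.-tuple R -> R) (K : d.-tuple R -> d.-tuple R -> R) :
  (forall i j, series (fun k => part k (xs i) (xs j)) @ \oo --> K (xs i) (xs j)) ->
  series (fun k => Omega c (part k) xs ys alpha) @ \oo --> Omega c K xs ys alpha.
Proof.
move=> cvK.
rewrite (_ : series _ = fun N => \sum_(y < c) \sum_(i < n) \sum_(j < n)
    alpha_lab alpha ys y i * series (fun k => part k (xs i) (xs j)) N * alpha_lab alpha ys y j).
  apply: cvg_finsum => y _; apply: cvg_finsum => i _; apply: cvg_finsum => j _.
  by apply: cvgM; [apply: cvgM; [exact: cvg_cst|exact: cvK]|exact: cvg_cst].
apply/funext => N; rewrite seriesEord/= /Omega exchange_big; apply: eq_bigr => y _.
rewrite exchange_big; apply: eq_bigr => i _; rewrite exchange_big; apply: eq_bigr => j _.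
by rewrite seriesEord/= mulr_sumr mulr_suml.
Qed.

Lemma Omega_rank_one (b : R) k :
  Omega c (fun x t => b * (psi k x * psi k t)) xs ys alpha =
  b * \sum_(y < c) label_feature y k ^+ 2.
Proof.
rewrite /Omega mulr_sumr; apply: eq_bigr => y _.
rewrite expr2 /label_feature mulr_suml mulr_sumr; apply: eq_bigr => i _.
rewrite !mulr_sumr; apply: eq_bigr => j _; ring.
Qed.

(** Omega is linear in the kernel and nonnegative on each rank-one term, so its partial sums
    increase to the two constrained values. *)
Lemma sum_label_feature_le K (Bp Bm : R) :
  Omega c (Splus lam phi) xs ys alpha <= Bp ^+ 2 ->
  Omega c (Sminus lam phi) xs ys alpha <= Bm ^+ 2 ->
  \sum_(y < c) \sum_(k < K) label_feature y k ^+ 2 <= Bp ^+ 2 + Bm ^+ 2.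
Proof.
move=> OBp OBm.
have part_ge0 (b : bool) k : 0 <= b%:R * \sum_(y < c) label_feature y k ^+ 2.
  by rewrite mulr_ge0// sumr_ge0// => y _; exact: sqr_ge0.
have cvp := Omega_cvg (fun i j => cvg_Splus (Xxs i) (Xxs j)).
have cvm := Omega_cvg (fun i j => cvg_Sminus (Xxs i) (Xxs j)).
have lep : series (fun k => Omega c (plus_part k) xs ys alpha) K <= Bp ^+ 2.
  apply: le_trans OBp; rewrite -(cvg_lim _ cvp)//.
  apply: nondecreasing_cvgn_le; last by apply/cvg_ex; eexists; exact: cvp.
  by apply: nondecreasing_series => k _ _; rewrite Omega_rank_one.
have lem : series (fun k => Omega c (minus_part k) xs ys alpha) K <= Bm ^+ 2.
  apply: le_trans OBm; rewrite -(cvg_lim _ cvm)//.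
  apply: nondecreasing_cvgn_le; last by apply/cvg_ex; eexists; exact: cvm.
  by apply: nondecreasing_series => k _ _; rewrite Omega_rank_one.
apply: le_trans (lerD lep lem).
rewrite exchange_big !seriesEord/= -big_split/=; apply: ler_sum => k _.
rewrite /plus_part /minus_part !Omega_rank_one.
by case: ger0P => _; rewrite ?mul1r ?mul0r ?addr0 ?add0r.
Qed.

(** The score is linear in the features of x, with the signed [label_feature] as weights. *)
Lemma cvg_hS x y : X x ->
  \sum_(k < K) sg k * label_feature y k * psi k x @[K --> \oo] --> hS S xs ys alpha x y.
Proof.
move=> Xx.
have -> : hS S xs ys alpha x y = \sum_(i < n) alpha_lab alpha ys y i * S x (xs i).
  rewrite /hS big_mkcond/=; apply: eq_bigr => i _.
  by rewrite /alpha_lab; case: ifP; rewrite ?mul0r.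
rewrite (_ : (fun _ => _) = fun K => \sum_(i < n) alpha_lab alpha ys y i *
    \sum_(k < K) sg k * psi k x * psi k (xs i)).
  apply: cvg_finsum => i _; apply: cvgM; first exact: cvg_cst.
  exact: cvg_spectral.
apply/funext => K; under [RHS]eq_bigr do rewrite mulr_sumr.
rewrite exchange_big/=; apply: eq_bigr => k _.
by rewrite /label_feature mulr_sumr mulr_suml; apply: eq_bigr => i _; ring.
Qed.

End sample.

End spectral_features.

(** * A countable family approximating the ball of weights *)

Section countable_weights.
Context {R : realType} {d : nat}.
Variables (c : nat) (b : R).

(* A code (K, N, a) stands for the weights a_(y,k) / (N + 1), k < K. *)
Definition weight_code : Type := (nat * nat * seq (seq int))%type.

Definition code_weight (q : weight_code) (y k : nat) : R :=
  if (k < q.1.1)%N then (nth 0 (nth [::] q.2 y) k)%:~R / q.1.2.+1%:R else 0.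

Definition admissible (q : weight_code) : bool :=
  \sum_(y < c) \sum_(k < q.1.1) code_weight q y k ^+ 2 <= b ^+ 2.

(** Indices that decode to nothing, or to weights outside the ball, get the zero code, so every
    index obeys the norm bound. *)
Definition class_code (j : nat) : weight_code :=
  if unpickle j is Some q then if admissible q then q else (0, 0, [::])%N
  else (0, 0, [::])%N.

Definition class_weight (j y k : nat) : R := code_weight (class_code j) y k.
Definition class_dim (j : nat) : nat := (class_code j).1.1.

Lemma class_weight_dim j y k : (class_dim j <= k)%N -> class_weight j y k = 0.
Proof. by move=> jk; rewrite /class_weight /code_weight ltnNge jk. Qed.

(** Padding with zeros lets finitely many members share one dimension K. *)
Lemma sum_class_weight (F : nat -> R -> R) j K :
  (class_dim j <= K)%N -> (forall k, F k 0 = 0) ->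
  forall y, \sum_(k < K) F k (class_weight j y k) =
            \sum_(k < class_dim j) F k (class_weight j y k).
Proof.
move=> jK F0 y; rewrite -(subnKC jK) big_split_ord/= [X in _ + X]big1 ?addr0// => k _.
by rewrite class_weight_dim ?F0//= leq_addr.
Qed.

Lemma class_weight_norm j :
  \sum_(y < c) \sum_(k < class_dim j) class_weight j y k ^+ 2 <= b ^+ 2.
Proof.
rewrite /class_dim /class_weight /class_code.
have z : \sum_(y < c) \sum_(k < 0) code_weight (0%N, 0%N, [::]) y k ^+ 2 <= b ^+ 2.
  by rewrite big1 ?sqr_ge0// => y _; rewrite big_ord0.
by case: (unpickle j) => [q|//]; case: ifP.
Qed.

(** Rounding toward zero rather than to the nearest point keeps absolute values from growing, so
    rounded weights stay in the ball. *)
Lemma round_toward_zero (x : R) (N : nat) : exists a : int,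
  `|a%:~R / N.+1%:R| <= `|x| /\ `|a%:~R / N.+1%:R - x| <= N.+1%:R^-1.
Proof.
have N0 : 0 < N.+1%:R :> R by rewrite ltr0n.
have pos (u : R) : 0 <= u ->
    exists a : nat, a%:R / N.+1%:R <= u /\ u - a%:R / N.+1%:R <= N.+1%:R^-1.
  move=> u0; pose a := Num.truncn (u * N.+1%:R); exists a.
  have /andP[t1] : a%:R <= u * N.+1%:R < a.+1%:R.
    by apply: truncn_itv; rewrite mulr_ge0// ltW.
  rewrite -[a.+1%:R]natr1 => t2.
  split; first by rewrite ler_pdivrMr.
  have -> : u - a%:R / N.+1%:R = (u * N.+1%:R - a%:R) / N.+1%:R by field; rewrite gt_eqF.
  by rewrite ler_pdivrMr// mulVf ?gt_eqF//; lra.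
have aN0 (a : nat) : 0 <= a%:R / N.+1%:R :> R by rewrite divr_ge0// ltW.
have [x0|x0] := leP 0 x.
  have [a [a1 a2]] := pos x x0; exists a.
  by rewrite pmulrn (ger0_norm (aN0 a)) (ger0_norm x0) distrC ger0_norm ?subr_ge0.
have [|a [a1 a2]] := pos (- x); first by rewrite oppr_ge0 ltW.
exists (- (a : int)); rewrite mulrNz mulNr normrN pmulrn (ger0_norm (aN0 a)) (ltr0_norm x0).
by split=> //; rewrite addrC ger0_norm// subr_ge0.
Qed.

Lemma class_weight_approx (v : nat -> nat -> R) (K N : nat) :
  \sum_(y < c) \sum_(k < K) v y k ^+ 2 <= b ^+ 2 ->
  exists j, class_dim j = K /\ forall y k, (y < c)%N -> (k < K)%N ->
    `|class_weight j y k - v y k| <= N.+1%:R^-1.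
Proof.
move=> vb.
have /choice[a ha] : forall p : nat * nat, exists a : int,
  `|a%:~R / N.+1%:R| <= `|v p.1 p.2| /\ `|a%:~R / N.+1%:R - v p.1 p.2| <= N.+1%:R^-1.
  by move=> p; exact: round_toward_zero.
pose q : weight_code := (K, N, mkseq (fun y => mkseq (fun k => a (y, k)) K) c).
have qE y k : (y < c)%N -> (k < K)%N -> code_weight q y k = (a (y, k))%:~R / N.+1%:R.
  by move=> yc kK; rewrite /code_weight /= kK nth_mkseq// nth_mkseq.
have adm : admissible q.
  apply: le_trans vb; apply: ler_sum => y _; apply: ler_sum => k _.
  rewrite qE// -[leLHS]ger0_norm ?sqr_ge0// -[leRHS]ger0_norm ?sqr_ge0//.
  by rewrite !normrX lerXn2r ?nnegrE// (ha (_, _)).1.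
have jq : class_code (pickle q) = q by rewrite /class_code pickleK adm.
exists (pickle q); rewrite /class_dim /class_weight jq; split=> // y k yc kK.
by rewrite qE//; exact: (ha (y, k)).2.
Qed.

Definition class_score (psi : nat -> d.-tuple R -> R) (j : nat) (x : d.-tuple R) (y : nat) : R :=
  \sum_(k < class_dim j) class_weight j y k * psi k x.

Lemma class_score_approx (X : set (d.-tuple R)) (psi : nat -> d.-tuple R -> R) (M : R)
    (v : nat -> nat -> R) (h : d.-tuple R -> nat -> R) :
  (forall k x, X x -> `|psi k x| <= M) ->
  (forall K, \sum_(y < c) \sum_(k < K) v y k ^+ 2 <= b ^+ 2) ->
  (forall x y, X x -> \sum_(k < K) v y k * psi k x @[K --> \oo] --> h x y) ->
  exists u : nat -> nat, forall x y, X x -> (y < c)%N ->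
    class_score psi (u K) x y @[K --> \oo] --> h x y.
Proof.
move=> psiM vb vh.
(* The first K weights are rounded on a grid of step 1/(K+1)^2; the K errors then add up to at most
   M/(K+1). The choice depends on K alone and serves all x and y. *)
have /choice[u hu] : forall K, exists j, class_dim j = K /\ forall y k, (y < c)%N -> (k < K)%N ->
    `|class_weight j y k - v y k| <= (K.+1 * K.+1)%N%:R^-1.
  by move=> K; have := class_weight_approx (K.+1 * K.+1).-1 (vb K).
exists u => x y Xx yc; apply: cvg_sub0 (vh x y Xx).
apply/norm_cvg0P.
have M0 : 0 <= M by apply: le_trans (psiM 0%N x Xx).
apply: (@squeeze_cvgr _ _ _ _ (fun=> 0) (fun K => M * harmonic K)).
- apply: nearW => K; rewrite normr_ge0/= /class_score.
  have [dK wK] := hu K; rewrite !fctE dK -sumrB.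
  apply: le_trans (ler_norm_sum _ _ _) _.
  apply: (@le_trans _ _ (\sum_(k < K) ((K.+1 * K.+1)%N%:R^-1 * M))).
    apply: ler_sum => k _; rewrite -mulrBl normrM ler_pM//; last exact: psiM.
    exact: wK.
  rewrite sumr_const card_ord -[leLHS]mulr_natl natrM invfM mulrA mulrC ler_wpM2l//.
  rewrite /harmonic/= mulrA ler_piMl ?invr_ge0//.
  by rewrite ler_pdivrMr ?ltr0n// mul1r ler_nat.
- exact: cvg_cst.
- rewrite -[X in _ --> X](mulr0 M); apply: cvgM; first exact: cvg_cst.
  exact: cvg_harmonic.
Qed.

End countable_weights.

(** * Risk bound *)

Section limits.
Context {R : realType}.

Lemma Rintegral_bounded_cvg {dW : measure_display} {W : measurableType dW}
    (P : probability W R) (f_ : nat -> W -> R) (f : W -> R) (M : R) :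
  (forall n, bounded_mfun (f_ n)) -> bounded_mfun f -> (forall n x, `|f_ n x| <= M) ->
  (forall x, f_ n x @[n --> \oo] --> f x) ->
  \int[P]_x f_ n x @[n --> \oo] --> \int[P]_x f x.
Proof.
move=> bf_ bf fM ff; apply: fine_cvg; rewrite bounded_RintegralEFin//.
apply: (@dominated_cvg _ _ _ _ _ _ (fun n x => (f_ n x)%:E) (fun x => (f x)%:E) (fun=> M%:E)) => //.
- by move=> n; apply/measurable_EFinP; case: (bf_ n).
- by move=> x _; apply: cvg_EFin; [exact: nearW|exact: ff].
- exact: (bounded_mfun_integrable P (bounded_mfun_cst M)).
- by move=> n x _; rewrite lee_fin.
Qed.

Lemma margin_loss_cvg (W : Type) c gamma (h_ : nat -> W -> nat -> R) (h : W -> nat -> R) z :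
  (1 < c)%N -> 0 < gamma -> (forall y, (y < c)%N -> h_ n z.1 y @[n --> \oo] --> h z.1 y) ->
  margin_loss c gamma (h_ n) z @[n --> \oo] --> margin_loss c gamma h z.
Proof.
move=> c1 g0 hh.
have dist0 : gamma^-1 * \sum_(y < c) `|h_ n z.1 y - h z.1 y| @[n --> \oo] --> (0 : R).
  rewrite -[X in _ --> X](mulr0 gamma^-1); apply: cvgM; first exact: cvg_cst.
  rewrite [X in _ --> X](_ : 0 = \sum_(y < c) (0 : R)); last by rewrite big1.
  apply: cvg_finsum => y _; rewrite -(normr0 R) -(subrr (h z.1 y)).
  by apply: cvg_norm; apply: cvgB; [exact: hh|exact: cvg_cst].
apply: (@cvg_sub0 _ _ _ _ _ _ (fun=> margin_loss c gamma h z)); last exact: cvg_cst.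
apply/norm_cvg0P; apply: squeeze_cvgr (cvg_cst 0) dist0.
apply: nearW => n; rewrite normr_ge0/= !fctE ler_norml margin_loss_lipschitz// andbT.
rewrite lerNl opprB; apply: le_trans (margin_loss_lipschitz _ _ _ c1 g0) _.
by under eq_bigr do rewrite distrC.
Qed.

(** On an error the predicted label is a competitor scoring at least as high as the true one, so the
    margin is not positive. *)
Lemma fS_neq_margin_loss (d c : nat) (y0 : 'I_c) gamma (h : d.-tuple R -> nat -> R) z :
  (1 < c)%N -> 0 < gamma -> (z.2 < c)%N -> z.2 != fS y0 h z.1 -> margin_loss c gamma h z = 1.
Proof.
move=> c1 g0 zc; rewrite /fS; case: arg_maxP => // k _ kmax zk.
rewrite margin_lossE//; apply: ramp_le0; rewrite pmulr_lle0 ?invr_gt0// subr_le0.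
apply: (le_trans (kmax (Ordinal zc) isT)).
by apply: max_other_ge; rewrite 1?eq_sym.
Qed.

End limits.

Section class_deviation.
Context {R : realType} {d : nat}.
Variables (mu : probability (d.-tuple R * nat)%type R) (c n : nat).
Hypotheses (c1 : (1 < c)%N) (n0 : (0 < n)%N).
Variables (gamma b r delta : R) (psi : nat -> d.-tuple R -> R).
Hypotheses (gamma0 : 0 < gamma) (b0 : 0 < b) (r0 : 0 < r) (delta01 : 0 < delta < 1)
  (bpsi : forall k, bounded_mfun (psi k))
  (psir : forall K x, \sum_(k < K) psi k x ^+ 2 <= 2 * r ^+ 2).

Definition class_loss j : d.-tuple R * nat -> R :=
  margin_loss c gamma (class_score c b psi j).

Lemma bounded_mfun_class_score j y : bounded_mfun (class_score c b psi j ^~ y).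
Proof.
by apply: bounded_mfun_sum => k; apply: bounded_mfunM => //; exact: bounded_mfun_cst.
Qed.

Lemma bounded_mfun_class_loss j : bounded_mfun (class_loss j).
Proof. by apply: bounded_mfun_margin_loss; exact: bounded_mfun_class_score. Qed.

(** Weights of all labels form one vector indexed by pairs (label, k). The feature vector of label y
    vanishes outside block y, so its inner product with the weights is the y-th score. *)
Lemma class_loss_deviation :
  measurable [set t : n.-tuple _ |
    exists j, (deviation_bound c n gamma^-1 r b delta < deviation mu (class_loss j) t)%R] /\
  (iid mu n [set t | exists j,
    (deviation_bound c n gamma^-1 r b delta < deviation mu (class_loss j) t)%R] <= delta%:E)%E.
Proof.
apply: countable_class_deviation => [j|m]; first exact: bounded_mfun_class_loss.
pose K := \max_(j < m.+1) class_dim c b j.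
have leK (j : 'I_m.+1) : (class_dim c b j <= K)%N.
  exact: (leq_bigmax (F := fun j : 'I_m.+1 => class_dim c b j)).
pose w (j : 'I_m.+1) (p : 'I_c * 'I_K) := class_weight c b j p.1 p.2.
pose f (y : 'I_c) (z : d.-tuple R * nat) (p : 'I_c * 'I_K) := (p.1 == y)%:R * psi p.2 z.1.
have dotE j y z : dot (w j) (f y z) = class_score c b psi j z.1 y.
  rewrite /dot -(pair_bigA _ (fun (y' : 'I_c) (k : 'I_K) =>
    class_weight c b j y' k * ((y' == y)%:R * psi k z.1)))/=.
  rewrite (bigD1 y)//= [X in _ + X]big1 ?addr0 => [|y' /negbTE yy']; last first.
    by apply: big1 => k _; rewrite yy' mul0r mulr0.
  rewrite /class_score -(sum_class_weight (F := fun k a => a * psi k z.1) (leK j)); last first.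
    by move=> k; rewrite mul0r.
  by apply: eq_bigr => k _; rewrite eqxx mul1r.
apply: (@finite_class_deviation _ _ _ mu m c n _ w f) => //.
- exact: ltnW.
- by rewrite invr_gt0.
- by move=> j; exact: bounded_mfun_class_loss.
- by move=> j z; exact: margin_loss_ge0_le1.
- move=> y p; apply: bounded_mfunM; first exact: bounded_mfun_cst.
  exact: (bounded_mfun_comp (bpsi _) measurable_fst).
- move=> z j k; under eq_bigr do rewrite !dotE.
  by apply: margin_loss_lipschitz.
- move=> j; rewrite /dot -(pair_bigA _ (fun (y : 'I_c) (k : 'I_K) =>
    class_weight c b j y k * class_weight c b j y k))/=.
  apply: le_trans (class_weight_norm c b j); apply: ler_sum => y _.
  by rewrite -(sum_class_weight (F := fun k a => a ^+ 2) (leK j))// => k; rewrite expr0n.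
- move=> y z; rewrite /dot -(pair_bigA _ (fun (y' : 'I_c) (k : 'I_K) =>
    (y' == y)%:R * psi k z.1 * ((y' == y)%:R * psi k z.1)))/=.
  rewrite (bigD1 y)//= [X in _ + X]big1 ?addr0 => [|y' /negbTE yy']; last first.
    by apply: big1 => k _; rewrite yy' !mul0r.
  by under eq_bigr do rewrite eqxx mul1r -expr2; exact: psir.
Qed.

End class_deviation.

Section risk_limit.
Context {R : realType} {d : nat}.

(** On the misclassified points of the support the limiting loss is 1, so the losses of [h_ K]
    integrated over that set tend to the risk. The loss of [h] itself is never integrated; only
    measurability of [h] on X, as a limit, enters. *)
Lemma risk_le_limit (X : set (d.-tuple R)) (mu : probability (d.-tuple R * nat)%type R)
    (c : nat) (y0 : 'I_c) (gamma : R) (h_ : nat -> d.-tuple R -> nat -> R)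
    (h : d.-tuple R -> nat -> R) (a_ : nat -> R) (a : R) :
  (1 < c)%N -> 0 < gamma -> measurable X ->
  mu (X `*` [set y | (y < c)%N]) = 1%E ->
  (forall K y, bounded_mfun (h_ K ^~ y)) ->
  (forall x y, X x -> (y < c)%N -> h_ K x y @[K --> \oo] --> h x y) ->
  (forall K, \int[mu]_z margin_loss c gamma (h_ K) z <= a_ K) ->
  a_ K @[K --> \oo] --> a ->
  (risk X mu (fS y0 h) <= a%:E)%E.
Proof.
move=> c1 g0 mX muD bh hh loss_le a_a; rewrite /risk.
set A := [set z | _]; set D := X `*` _ in muD.
have mD : measurable D by exact: measurableX.
have mA : measurable A.
  apply: measurable_fS_neq => // y yc.
  apply: (@measurable_fun_cvg _ _ _ _ (fun K => h_ K ^~ y)) => [K|x Xx]; last exact: hh.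
  by apply: measurable_funTS; exact: (bh K y).1.
have muDC : mu (~` D) = 0%E by rewrite probability_setC// muD subee.
have muAD : mu (A `\` D) = 0%E.
  apply: (subset_measure0 (B := ~` D)) => //; first exact: measurableD.
  exact: measurableC.
have -> : mu A = mu (A `&` D).
  by transitivity (mu (A `\` D) + mu (A `&` D))%E; [exact: measureDI|rewrite muAD add0e].
have mAD : measurable (A `&` D) by exact: measurableI.
rewrite probability_Rintegral_indic// lee_fin.
have bind : bounded_mfun (\1_(A `&` D) : _ -> R).
  split; first exact: measurable_indic.
  by exists 1 => x; rewrite ger0_norm// indicE; case: (_ \in _).
have bloss K : bounded_mfun (margin_loss c gamma (h_ K)) by exact: bounded_mfun_margin_loss.
have lim : \int[mu]_z (\1_(A `&` D) z * margin_loss c gamma (h_ K) z) @[K --> \oo] -->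
    \int[mu]_z \1_(A `&` D) z.
  apply: (@Rintegral_bounded_cvg _ _ _ _ _ _ 1) => //.
  - by move=> K; exact: bounded_mfunM.
  - move=> K z; have /andP[l0 l1] := margin_loss_ge0_le1 c gamma (h_ K) z.
    by rewrite ger0_norm ?mulr_ge0// ?mulr_ile1// indicE; case: (_ \in _).
  move=> z; rewrite indicE; have [|_] := boolP (z \in _); last first.
    by under eq_fun do rewrite mul0r; exact: cvg_cst.
  rewrite inE => -[[Xz zf] [_ zc]]; under eq_fun do rewrite mul1r.
  rewrite -(fS_neq_margin_loss c1 g0 zc zf).
  by apply: margin_loss_cvg => // y yc; exact: hh.
apply: ler_cvg_to lim a_a _; apply: nearW => K; apply: le_trans (loss_le K).
apply: le_Rintegral_bounded => //; first exact: bounded_mfunM.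
move=> z; have /andP[l0 l1] := margin_loss_ge0_le1 c gamma (h_ K) z.
by rewrite indicE; case: (_ \in _); rewrite ?mul1r ?mul0r.
Qed.

End risk_limit.

(** The mean term compares through 3 <= 8 (2 c - 1); the concentration term through ln (1 / delta)
    <= ln (4 / delta) and a prefactor at least 1. *)
Lemma deviation_bound_rate {R : realType} (c n : nat) (gamma r b delta : R) :
  (1 < c)%N -> (0 < n)%N -> 0 < gamma -> 0 < r -> 0 < b -> 0 < delta < 1 ->
  deviation_bound c n gamma^-1 r b delta / n%:R <=
  8 * r * (2 * c%:R - 1) * c%:R * b / (gamma * Num.sqrt n%:R)
  + (16 * c%:R * (2 * c%:R - 1) * b * r ^+ 2 / gamma + 1)
    * Num.sqrt (ln (4 / delta) / (2 * n%:R)).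
Proof.
move=> c1 n0 g0 r0 b0 /andP[d0 d1].
have nR : 0 < n%:R :> R by rewrite ltr0n.
have cR : 1 < c%:R :> R by rewrite ltr1n.
have sn0 : 0 < Num.sqrt n%:R :> R by rewrite sqrtr_gt0.
rewrite /deviation_bound mulrDl; apply: lerD.
  have -> : 3 * c%:R * gamma^-1 * r * b * Num.sqrt n%:R / n%:R =
      (r * c%:R * b / (gamma * Num.sqrt n%:R)) * 3.
    rewrite -[X in _ / X = _](sqr_sqrtr (ltW nR)); field.
    by rewrite !gt_eqF.
  have -> : 8 * r * (2 * c%:R - 1) * c%:R * b / (gamma * Num.sqrt n%:R) =
      (r * c%:R * b / (gamma * Num.sqrt n%:R)) * (8 * (2 * c%:R - 1)).
    by field; rewrite !gt_eqF.
  rewrite ler_wpM2l//; last lra.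
  by rewrite divr_ge0 ?mulr_ge0// ltW// (lt_trans _ cR).
have ln0 : 0 <= ln (1 / delta) by apply: ln_ge0; rewrite ler_pdivlMr// mul1r ltW.
have lnle : ln (1 / delta) <= ln (4 / delta).
  by rewrite ler_ln ?posrE ?divr_gt0// ler_pM2r ?invr_gt0//; lra.
have -> : Num.sqrt (n%:R / 2 * ln (1 / delta)) / n%:R = Num.sqrt (ln (1 / delta) / (2 * n%:R)).
  have nE : n%:R = Num.sqrt (n%:R ^+ 2) :> R by rewrite sqrtr_sqr ger0_norm// ltW.
  rewrite [X in Num.sqrt _ / X]nE -sqrtrV ?sqr_ge0//.
  rewrite -sqrtrM; last by rewrite mulr_ge0 ?divr_ge0// ltW.
  by congr Num.sqrt; field; rewrite gt_eqF.
apply: (@le_trans _ _ (Num.sqrt (ln (4 / delta) / (2 * n%:R)))).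
  by rewrite ler_wsqrtr// ler_pM2r// invr_gt0 mulr_gt0.
rewrite ler_peMl ?sqrtr_ge0// lerDr divr_ge0 ?(ltW g0)//.
rewrite !mulr_ge0 ?sqr_ge0//; lra.
Qed.

Section feature_map.
Context {R : realType} {d : nat}.
Variables (X : set (d.-tuple R)) (lam : nat -> R) (phi : nat -> d.-tuple R -> R) (r : R).
Hypotheses (mX : measurable X) (phi_meas : forall k, measurable_fun X (phi k))
  (sum_le : forall x K, X x -> \sum_(k < K) spectral_feature lam phi k x ^+ 2 <= 2 * r ^+ 2).

(** Extension by zero outside X makes the features bounded and measurable on the whole space. *)
Definition extended_feature k : d.-tuple R -> R := spectral_feature lam phi k \_ X.

Lemma extended_featureE k x : X x -> extended_feature k x = spectral_feature lam phi k x.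
Proof. by move=> Xx; rewrite /extended_feature patchE mem_set. Qed.

Lemma sum_extended_feature_le K x : \sum_(k < K) extended_feature k x ^+ 2 <= 2 * r ^+ 2.
Proof.
have [Xx|nXx] := pselect (X x).
  by under eq_bigr do rewrite extended_featureE//; exact: sum_le.
rewrite big1 => [|k _]; first by apply: mulr_ge0; [|exact: sqr_ge0].
by rewrite /extended_feature patchE memNset// expr0n.
Qed.

Lemma normr_extended_feature_le k x : `|extended_feature k x| <= 1 + 2 * r ^+ 2.
Proof.
have := sum_extended_feature_le k.+1 x; rewrite big_ord_recr/=.
have : 0 <= \sum_(i < k) extended_feature i x ^+ 2 by apply: sumr_ge0 => i _; exact: sqr_ge0.
rewrite -[extended_feature k x ^+ 2]real_normK ?num_real//.
have := sqr_ge0 (`|extended_feature k x| - 1); rewrite sqrrB1.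
have := normr_ge0 (extended_feature k x).
set a := `|_|; set s := \sum_(_ < _) _; nra.
Qed.

Lemma bounded_mfun_extended_feature k : bounded_mfun (extended_feature k).
Proof.
split; last by exists (1 + 2 * r ^+ 2) => x; exact: normr_extended_feature_le.
apply/(measurable_restrictT _ mX).
exact: (measurable_funM (measurable_cst _) (phi_meas k)).
Qed.

End feature_map.

Lemma probability_ge_setI {R : realType} {dO : measure_display} {Om : measurableType dO}
    (P : probability Om R) (A B : set Om) (delta : R) :
  measurable A -> measurable B -> (P (~` A) <= delta%:E)%E -> P B = 1%E ->
  ((1 - delta)%:E <= P (A `&` B))%E.
Proof.
move=> mA mB PA PB.
have mAB : measurable (A `&` B) by exact: measurableI.
have PBC : (P (~` B) <= 0)%E by rewrite probability_setC// PB subee.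
have : (P (~` (A `&` B)) <= delta%:E)%E.
  rewrite setCI; apply: le_trans (measureU2 P (measurableC mA) (measurableC mB)) _.
  by apply: le_trans (leeD PA PBC) _; rewrite adde0.
rewrite probability_setC// -(fineK (fin_num_measure P _ mAB)) -EFinB !lee_fin; lra.
Qed.

Unset Implicit Arguments.
Theorem theorem3p2 (R : realType) (d c n : nat) (hc : (1 < c)%N) (hn : (0 < n)%N)
  (X : set (d.-tuple R)) (hX : compact_tup X)
  (leb : {measure set (d.-tuple R) -> \bar R}) (hleb : is_lebesgue_tuple leb)
  (S : d.-tuple R -> d.-tuple R -> R)
  (S01 : forall x t, X x -> X t -> 0 <= S x t <= 1)
  (Ssym : forall x t, X x -> X t -> S x t = S t x)
  (Scont : continuous_on_sq X S)
  (lam : nat -> R) (phi : nat -> d.-tuple R -> R)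
  (phi_meas : forall k, measurable_fun X (phi k))
  (phi_orthonormal : forall k l,
     (\int[leb]_(x in X) (phi k x * phi l x)%:E = (if k == l then 1 else 0)%:E)%E)
  (phi_eigen : forall k x, X x ->
     (\int[leb]_(t in X) (S x t * phi k t)%:E = (lam k * phi k x)%:E)%E)
  (C : R) (hC : 0 < C)
  (hsumC : forall x, X x ->
     cvgn (series (fun k => `|lam k| * phi k x ^+ 2)) /\
     limn (series (fun k => `|lam k| * phi k x ^+ 2)) < C)
  (S_decomp : forall x t, X x -> X t ->
     S x t = Splus lam phi x t - Sminus lam phi x t)
  (Bp Bm Rb : R) (hBp : 0 < Bp) (hBm : 0 < Bm) (hRb : 0 < Rb)
  (hSp : forall x, X x -> `|Splus lam phi x x| <= Rb ^+ 2)
  (hSm : forall x, X x -> `|Sminus lam phi x x| <= Rb ^+ 2)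
  (gamma delta : R) (hgamma : 0 < gamma) (hdelta0 : 0 < delta) (hdelta1 : delta < 1)
  (dO : measure_display) (Om : measurableType dO) (P : probability Om R)
  (PXY : probability (d.-tuple R * nat)%type R)
  (hPXY : PXY (X `*` [set y | (y < c)%N]) = 1%E)
  (Z : 'I_n -> Om -> (d.-tuple R * nat)%type)
  (hZ : iid_sample P Z PXY) :
  (exists E : set Om, measurable E /\ ((1 - delta)%:E <= P E)%E /\
    forall w, E w ->
    forall alpha : 'I_n -> R,
      (forall i, 0 <= alpha i) -> \sum_(i < n) alpha i = 1 ->
      Omega c (Splus lam phi) (fun i => (Z i w).1) (fun i => (Z i w).2) alpha
        <= Bp ^+ 2 ->
      Omega c (Sminus lam phi) (fun i => (Z i w).1) (fun i => (Z i w).2) alpha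
        <= Bm ^+ 2 ->
      (risk X PXY
         (fS (Ordinal (ltnW hc))
            (hS S (fun i => (Z i w).1) (fun i => (Z i w).2) alpha))
       <= (emp_risk c gamma (hS S (fun i => (Z i w).1) (fun i => (Z i w).2) alpha)
             (fun i => (Z i w).1) (fun i => (Z i w).2)
           + 8 * Rb * (2 * c%:R - 1) * c%:R * (Bp + Bm) / (gamma * Num.sqrt n%:R)
           + (16 * c%:R * (2 * c%:R - 1) * (Bp + Bm) * Rb ^+ 2 / gamma + 1)
             * Num.sqrt (ln (4 / delta) / (2 * n%:R)))%:E)%E)
  /\
  (forall (xs : 'I_n -> d.-tuple R) (ys : 'I_n -> nat),
    (forall i, X (xs i) /\ (ys i < c)%N) ->
    forall alpha : 'I_n -> R,
      (forall i, 0 <= alpha i) -> \sum_(i < n) alpha i = 1 ->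
      Omega c (Splus lam phi) xs ys alpha <= Bp ^+ 2 ->
      Omega c (Sminus lam phi) xs ys alpha <= Bm ^+ 2 ->
      1 <= gamma ->
      emp_risk c gamma (hS S xs ys alpha) xs ys
        <= 1 - (n%:R * gamma)^-1 *
               \sum_(i < n) \sum_(j < n) (alpha i + alpha j) / 2 * S (xs i) (xs j)
             + (n%:R * gamma)^-1 *
               \sum_(i < n) \sum_(j < n | (i < j)%N)
                  2 * (alpha i + alpha j) * S (xs i) (xs j) * (ys i != ys j)%:R).
Proof.
split; last first.
  move=> xs ys Xxs alpha a0 a1 _ _ g1.
  exact: (emp_risk_similarity_bound (X := X)).
have mX := compact_tup_measurable hX.
pose b := Bp + Bm.
have b0 : 0 < b by rewrite addr_gt0.
have summable x (Xx : X x) := (hsumC x Xx).1.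
have featle x K (Xx : X x) := sum_feature_sqr_le summable hSp hSm K Xx.
pose psi := extended_feature X lam phi.
have bpsi := bounded_mfun_extended_feature mX phi_meas featle : forall k, bounded_mfun (psi k).
have psiR := sum_extended_feature_le featle.
have delta01 : 0 < delta < 1 by rewrite hdelta0.
have [mBad Bad_le] := class_loss_deviation PXY hc hn hgamma b0 hRb delta01 bpsi psiR.
set Bad := [set t | _] in mBad Bad_le.
pose D : set (d.-tuple R * nat) := X `*` [set y | (y < c)%N].
have mD : measurable D by exact: measurableX.
pose Zt w := [tuple Z i w | i < n].
have mZt : measurable_fun [set: Om] Zt.
  apply/measurable_fun_tnthP => i.
  rewrite (_ : _ \o _ = Z i); first exact: hZ.1.
  by apply/funext => w /=; rewrite tnth_mktuple.
(* The second factor has probability 1; it places every sample point in X with a label in range,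
   where the approximation of the scores holds. *)
exists (Zt @^-1` (~` Bad) `&` \bigcap_(i in [set: 'I_n]) (Z i @^-1` D)).
have mA : measurable (Zt @^-1` (~` Bad)).
  by rewrite -[X in measurable X]setTI; apply: mZt => //; exact: measurableC.
have mB : measurable (\bigcap_(i in [set: 'I_n]) (Z i @^-1` D)).
  apply: fin_bigcap_measurable => // i _.
  by rewrite -[X in measurable X]setTI; exact: hZ.1.
split; first exact: measurableI.
split.
  apply: probability_ge_setI => //.
    by rewrite -preimage_setC setCK (iid_sample_law hZ).
  by rewrite hZ.2// big1// => i _; exact: hPXY.
move=> w [nBad ZD] alpha a0 a1 OBp OBm.
set xs := fun i => (Z i w).1; set ys := fun i => (Z i w).2.
have Xxs i : X (xs i) by have [] := ZD i Logic.I.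
have ysc i : (ys i < c)%N by have [] := ZD i Logic.I.
(* The sign goes to the weights, where squaring removes it: the indefinite kernel costs nothing in
   the norm. *)
pose v y k := spectral_sign lam k * label_feature lam phi xs ys alpha y k.
have v_norm K : \sum_(y < c) \sum_(k < K) v y k ^+ 2 <= b ^+ 2.
  have -> : \sum_(y < c) \sum_(k < K) v y k ^+ 2 =
      \sum_(y < c) \sum_(k < K) label_feature lam phi xs ys alpha y k ^+ 2.
    apply: eq_bigr => y _; apply: eq_bigr => k _; rewrite /v exprMn.
    by rewrite /spectral_sign; case: ifP; rewrite ?sqrrN expr1n mul1r.
  apply: le_trans (sum_label_feature_le summable Xxs K OBp OBm) _.
  by rewrite /b sqrrD; have := mulr_gt0 hBp hBm; rewrite mulr2n; lra.
have v_cvg x y : X x -> \sum_(k < K) v y k * psi k x @[K --> \oo] --> hS S xs ys alpha x y.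
  move=> Xx; have := cvg_hS summable S_decomp (ys := ys) (alpha := alpha) Xxs (y := y) Xx.
  rewrite (_ : (fun K => _) = fun K => \sum_(k < K) v y k * psi k x)//.
  apply/funext => K; apply: eq_bigr => k _.
  by rewrite /psi extended_featureE.
have [u u_cvg] := class_score_approx
  (fun k x _ => normr_extended_feature_le featle k x) v_norm v_cvg.
pose tau := deviation_bound c n gamma^-1 Rb b delta.
set h := hS S xs ys alpha.
(* Off [Bad], these quantities bound the true losses of the approximants; their limit is the
   empirical risk of [h] plus tau / n. *)
have cvg_emp : n%:R^-1 * (\sum_(i < n) class_loss c gamma b psi (u K) (Z i w) + tau) @[K --> \oo]
    --> emp_risk c gamma h xs ys + tau / n%:R.
  rewrite /emp_risk [tau / _]mulrC -mulrDr; apply: cvgM; first exact: cvg_cst.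
  apply: cvgD; last exact: cvg_cst.
  apply: cvg_finsum => i _; rewrite -(@margin_lossE _ _ c gamma h (Z i w)) ?ysc//.
  by apply: margin_loss_cvg => // y yc; apply: u_cvg => //; exact: Xxs.
have nR : 0 < n%:R :> R by rewrite ltr0n.
apply: le_trans (risk_le_limit
  (h_ := fun K => class_score c b psi (u K)) _ hc hgamma mX hPXY _ _ _ cvg_emp) _.
- by move=> K y; exact: (bounded_mfun_class_score c b bpsi (u K) y).
- exact: u_cvg.
- move=> K; rewrite ler_pdivlMl//.
  have : deviation PXY (class_loss c gamma b psi (u K)) (Zt w) <= tau.
    by rewrite leNgt; apply/negP => tlt; apply: nBad; exists (u K).
  rewrite /deviation sumrB sumr_const card_ord -[_ *+ n]mulr_natl lerBlDl.
  by under eq_bigr do rewrite tnth_mktuple.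
- by rewrite lee_fin -addrA lerD2l; exact: deviation_bound_rate.
Qed.
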